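(* If $f$ is a semiregular function on $B = B(0,R)$, then $f$ extends to a regular function on $B$ minus a union of isolated real points or isolated 2-spheres of the type $x+y\mathbb{S} = \{x+yI : I \in \mathbb{S}\}$ with $x,y \in \mathbb{R}$, $y \neq 0$. All the poles on each 2-sphere $x+y\mathbb{S}$ have the same order with the possible exception of one, which must have lesser order.
   Context: $\mathbb{H}$ is the skew field of real quaternions, $\mathbb{S} = \{q \in \mathbb{H} : q^2=-1\}$, $L_I = \mathbb{R} + I\mathbb{R}$ for $I\in\mathbb{S}$, $B(0,R)=\{q\in\mathbb{H}:|q|<R\}$ with $0<R\le\infty$. For a domain $\Omega\subseteq\mathbb{H}$ set $\Omega_I=\Omega\cap L_I$ and, for $f:\Omega\to\mathbb{H}$, $f_I=f|_{\Omega_I}$. A real differentiable $f:\Omega\to\mathbb{H}$ is regular if for every $I\in\mathbb{S}$ the function $\frac12\left(\frac{\partial}{\partial x}+I\frac{\partial}{\partial y}\right)f_I(x+Iy)$ vanishes identically on $\Omega_I$. Poles: if a regular $f$ is defined on an annulus $\{z\in L_I: R_1<|z-p|<R_2\}$ in a complex line $L_I$ through $p$ (for an isolated singularity in $L_I$, $R_1=0$), write $f_I(z)=\sum_{n\in\mathbb{Z}}(z-p)^na_n$ there, $a_n\in\mathbb{H}$ (for real $p$ the $a_n$ do not depend on $I$). The point $p$ is a pole if there is $n\in\mathbb{N}$ (possibly $0$) with $a_{-m}=0$ for all $m>n$; the minimum such $n$ is its (classical) order $ord_f(p)$ (order $0$ is allowed). Otherwise $p$ is an essential singularity. Semiregular: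 let $\mathcal{S}\subseteq\Omega$ be such that $\mathcal{S}\cap L_I$ is a discrete subset of $\Omega_I$ for all $I\in\mathbb{S}$; a regular function $f:\Omega\setminus\mathcal{S}\to\mathbb{H}$ is semiregular on $\Omega$ if $\mathcal{S}$ contains no essential singularities for $f$. *)

(* Defs.v *)
From HB Require Import structures.
From mathcomp Require Import all_boot all_order all_algebra.
From mathcomp Require Import ring lra.
From mathcomp Require Import all_classical all_reals all_analysis.

Set Implicit Arguments.
Unset Strict Implicit.
Unset Printing Implicit Defensive.

Import Order.TTheory GRing.Theory Num.Theory.
Import numFieldNormedType.Exports.

Local Open Scope classical_set_scope.
Local Open Scope ring_scope.

(* Real quaternions a + b i + c j + d k, as a real algebra with division and
   with the Euclidean norm (the topology of R^4). *)
Record quat (R : Type) := Quat { qr : R; qi : R; qj : R; qk : R }.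

Section QuatAlgebra.
Variable R : realType.
Local Notation H := (quat R).
Implicit Types p q : H.

Definition quat_tuple q := (qr q, qi q, qj q, qk q).
Definition tuple_quat (t : R * R * R * R) := Quat t.1.1.1 t.1.1.2 t.1.2 t.2.

Lemma quat_tupleK : cancel quat_tuple tuple_quat.
Proof. by case. Qed.

HB.instance Definition _ := Choice.copy H (can_type quat_tupleK).

Definition qadd p q :=
  Quat (qr p + qr q) (qi p + qi q) (qj p + qj q) (qk p + qk q).
Definition qopp q := Quat (- qr q) (- qi q) (- qj q) (- qk q).
Definition qmul p q := Quat
  (qr p * qr q - qi p * qi q - qj p * qj q - qk p * qk q)
  (qr p * qi q + qi p * qr q + qj p * qk q - qk p * qj q)
  (qr p * qj q - qi p * qk q + qj p * qr q + qk p * qi q)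
  (qr p * qk q + qi p * qj q - qj p * qi q + qk p * qr q).
Definition qscale (a : R) q := Quat (a * qr q) (a * qi q) (a * qj q) (a * qk q).
Definition qsqnorm q : R := qr q ^+ 2 + qi q ^+ 2 + qj q ^+ 2 + qk q ^+ 2.
Definition qinv q :=
  qscale (qsqnorm q)^-1 (Quat (qr q) (- qi q) (- qj q) (- qk q)).

Let qzero : H := Quat 0 0 0 0.
Let qone : H := Quat 1 0 0 0.

Lemma qaddA : associative qadd.
Proof. by move=> [? ? ? ?] [? ? ? ?] [? ? ? ?]; rewrite /qadd/= !addrA. Qed.
Lemma qaddC : commutative qadd.
Proof.
by move=> [a b c d] [? ? ? ?]; rewrite /qadd/= (addrC a) (addrC b) (addrC c) (addrC d).
Qed.
Lemma qadd0 : left_id qzero qadd.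
Proof. by case=> *; rewrite /qadd/= !add0r. Qed.
Lemma qaddN : left_inverse qzero qopp qadd.
Proof. by case=> *; rewrite /qadd/= !addNr. Qed.

HB.instance Definition _ := GRing.isZmodule.Build H qaddA qaddC qadd0 qaddN.

Lemma qmulA : associative qmul.
Proof.
by move=> [? ? ? ?] [? ? ? ?] [? ? ? ?]; rewrite /qmul/=; congr Quat; ring.
Qed.
Lemma qmul1 : left_id qone qmul.
Proof. by case=> *; rewrite /qmul/=; congr Quat; ring. Qed.
Lemma qmulr1 : right_id qone qmul.
Proof. by case=> *; rewrite /qmul/=; congr Quat; ring. Qed.
Lemma qmulDl : left_distributive qmul qadd.
Proof.
by move=> [? ? ? ?] [? ? ? ?] [? ? ? ?]; rewrite /qmul/qadd/=; congr Quat; ring.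
Qed.
Lemma qmulDr : right_distributive qmul qadd.
Proof.
by move=> [? ? ? ?] [? ? ? ?] [? ? ? ?]; rewrite /qmul/qadd/=; congr Quat; ring.
Qed.
Lemma qone_neq0 : qone != 0 :> H.
Proof. by apply/eqP => -[] /eqP; rewrite oner_eq0. Qed.

HB.instance Definition _ := GRing.Zmodule_isNzRing.Build H
  qmulA qmul1 qmulr1 qmulDl qmulDr qone_neq0.

Lemma qscaleA a b q : qscale a (qscale b q) = qscale (a * b) q.
Proof. by rewrite /qscale/= !mulrA. Qed.
Lemma qscale1 : left_id 1 qscale.
Proof. by case=> *; rewrite /qscale/= !mul1r. Qed.
Lemma qscaleDr : right_distributive qscale +%R.
Proof. by move=> a p q; congr Quat; rewrite mulrDr. Qed.
Lemma qscaleDl q : {morph qscale^~ q : a b / a + b}.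
Proof. by move=> a b; congr Quat; rewrite mulrDl. Qed.

HB.instance Definition _ := GRing.Zmodule_isLmodule.Build R H
  qscaleA qscale1 qscaleDr qscaleDl.

Lemma qscaleAl (a : R) p q : a *: (p * q) = (a *: p) * q.
Proof. by congr Quat => /=; ring. Qed.
HB.instance Definition _ := GRing.Lmodule_isLalgebra.Build R H qscaleAl.

Lemma qscaleAr (a : R) p q : a *: (p * q) = p * (a *: q).
Proof. by congr Quat => /=; ring. Qed.
HB.instance Definition _ := GRing.Lalgebra_isAlgebra.Build R H qscaleAr.

Lemma qsqnorm_ge0 q : 0 <= qsqnorm q.
Proof. by rewrite !addr_ge0 ?sqr_ge0. Qed.

Lemma qsqnorm_eq0 q : (qsqnorm q == 0) = (q == 0).
Proof.
case: q => a b c d; rewrite /qsqnorm/=.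
rewrite !paddr_eq0 ?addr_ge0 ?sqr_ge0// !sqrf_eq0.
apply/idP/eqP => [/andP[/andP[/andP[/eqP-> /eqP->] /eqP->] /eqP->]//|].
by case=> -> -> -> ->; rewrite eqxx.
Qed.

Fact qmulV : {in predC1 0, left_inverse 1 qinv *%R}.
Proof.
move=> q; rewrite !inE -qsqnorm_eq0 /qinv /qsqnorm.
by case: q => a b c d /= nz; congr Quat => /=; field.
Qed.
Fact qmulrV : {in predC1 0, right_inverse 1 qinv *%R}.
Proof.
move=> q; rewrite !inE -qsqnorm_eq0 /qinv /qsqnorm.
by case: q => a b c d /= nz; congr Quat => /=; field.
Qed.
Fact qunitP p q : q * p = 1 /\ p * q = 1 -> predC1 0 p.
Proof.
by case=> _ e /=; apply: contra_eq_neq e => ->; rewrite mul0r eq_sym oner_eq0.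
Qed.
Fact qinv_out : {in [predC predC1 0], qinv =1 id}.
Proof.
move=> q; rewrite !inE negbK => /eqP ->.
by rewrite /qinv/qscale/=; congr Quat; rewrite ?oppr0 mulr0.
Qed.

HB.instance Definition _ :=
  GRing.NzRing_hasMulInverse.Build H qmulV qmulrV qunitP qinv_out.

Definition qnorm q : R := Num.sqrt (qsqnorm q).

Lemma ler_qnormD p q : qnorm (p + q) <= qnorm p + qnorm q.
Proof.
rewrite -(@ler_pXn2r _ 2) ?nnegrE ?addr_ge0 ?sqrtr_ge0//.
rewrite sqrrD /qnorm !sqr_sqrtr ?qsqnorm_ge0// -sqrtrM ?qsqnorm_ge0//.
set s := Num.sqrt _; pose t := qr p * qr q + qi p * qi q + qj p * qj q + qk p * qk q.
suff ts : t <= s.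
  suff -> : qsqnorm (p + q) = qsqnorm p + t *+ 2 + qsqnorm q.
    by rewrite lerD2r lerD2l lerMn2r ts orbT.
  by rewrite /t /qsqnorm/=; ring.
apply: le_trans (ler_norm t) _; rewrite -sqrtr_sqr ler_wsqrtr// -subr_ge0.
rewrite (_ : _ - _ =
    (qr p * qi q - qi p * qr q) ^+ 2 + (qr p * qj q - qj p * qr q) ^+ 2
  + (qr p * qk q - qk p * qr q) ^+ 2 + (qi p * qj q - qj p * qi q) ^+ 2
  + (qi p * qk q - qk p * qi q) ^+ 2 + (qj p * qk q - qk p * qj q) ^+ 2).
  by rewrite !addr_ge0 ?sqr_ge0.
by rewrite /t /qsqnorm; ring.
Qed.
Lemma qnormZ (a : R) q : qnorm (a *: q) = `|a| * qnorm q.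
Proof.
rewrite /qnorm -sqrtr_sqr -sqrtrM ?sqr_ge0//; congr Num.sqrt.
by rewrite /qsqnorm/=; ring.
Qed.
Lemma qnorm_eq0 q : qnorm q = 0 -> q = 0.
Proof.
move=> /eqP; rewrite sqrtr_eq0 => q0; apply/eqP.
by rewrite -qsqnorm_eq0 eq_le q0 qsqnorm_ge0.
Qed.

HB.instance Definition _ := Lmodule_isNormed.Build R H ler_qnormD qnormZ qnorm_eq0.

End QuatAlgebra.

Section SemiregularFunctions.
Variable R : realType.
Local Notation H := (quat R).
Implicit Types (D T : set H) (f : H -> H) (p q I : H) (a : int -> H).

Definition imag_units : set H := [set I | I ^+ 2 = -1].

Definition slice I : set H := [set q | exists x y : R, q = x%:A + y *: I].

(* x + y S; reduced to the real point x when y = 0 *)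
Definition sphere (x y : R) : set H :=
  [set q | exists2 I, imag_units I & q = x%:A + y *: I].

Definition qball (r : \bar R) : set H := [set q | (`|q|%:E < r)%E].

(* Functions defined on a set D are represented by total functions; their
   values outside D are never used. *)

Definition domain D := open D /\ connected D.

Definition dbar I f (x y : R) : H :=
  2^-1 *: (derive1 (fun s : R => f (s%:A + y *: I)) x
           + I * derive1 (fun t : R => f (x%:A + t *: I)) y).

Definition regular D f :=
  [/\ domain D,
      forall q, D q -> differentiable f q &
      forall I, imag_units I ->
        forall x y : R, D (x%:A + y *: I) -> dbar I f x y = 0].

Definition bilateral_sum (u : int -> H) (s : H) :=
  exists s1 s2, [/\ [series u (Posz n)]_n @ \oo --> s1,
    [series u (Negz n)]_n @ \oo --> s2 & s = s1 + s2].

Definition annulus I p (r1 r2 : R) : set H :=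
  [set z | slice I z /\ r1 < `|z - p| < r2].

Definition laurent f I p (r1 r2 : R) a :=
  forall z, annulus I p r1 r2 z ->
    bilateral_sum (fun n => (z - p) ^ n * a n) (f z).

(* The line L_I through p is unique unless p is real, in which case the
   Laurent coefficients are the same in all the L_I; hence the line is
   existentially quantified. *)

Definition isolated_singularity D p :=
  exists I (r : R), [/\ imag_units I, slice I p, 0 < r & annulus I p 0 r `<=` D].

Definition order_le D f p (n : nat) :=
  exists I (r : R) a, [/\ imag_units I, slice I p,
    0 < r /\ annulus I p 0 r `<=` D,
    laurent f I p 0 r a &
    forall m : nat, (n < m)%N -> a (- m%:Z) = 0].

Definition pole D f p := exists n, order_le D f p n.

Definition has_order D f p (n : nat) :=
  order_le D f p n /\ forall k, order_le D f p k -> (n <= k)%N.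

Definition essential_singularity D f p :=
  isolated_singularity D p /\ ~ pole D f p.

(* As regular requires a domain, D \ T is open and connected here. *)
Definition semiregular D T f :=
  [/\ T `<=` D,
      forall I, imag_units I -> T `&` slice I `<=` isolated (T `&` slice I),
      regular (D `\` T) f &
      forall p, T p -> ~ essential_singularity (D `\` T) f p].

(* A sphere is isolated in T when some open set meets T exactly in it. *)
Definition isolated_points_or_spheres T :=
  forall q, T q ->
    (exists x : R, q = x%:A /\ isolated T q) \/
    (exists x y : R, [/\ y != 0, sphere x y q &
       exists2 V, open V & V `&` T = sphere x y]).

End SemiregularFunctions.

(* Main.v *)
Require Import Defs.
From HB Require Import structures.
From mathcomp Require Import all_boot all_order all_algebra.
From mathcomp Require Import ring lra.
From mathcomp Require Import all_classical all_reals all_analysis.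

(** The slices L_I of H are tied together by the representation formula: for
    units I <> J and K,
      f (x + y K) = (K - J) (I - J)^-1 f (x + y I) + (I - K) (I - J)^-1 f (x + y J),
    because the difference of the two sides is holomorphic in x + y K and vanishes
    for y = 0. So two regular points on a sphere x + y S determine f on the whole
    sphere and nearby spheres, and conversely one regular point forces others
    close to it. Let T be the union of the spheres and real points contained in S
    (sym_core). Off T the right-hand side defines a regular extension of f
    (extension_regular), and T meets every slice in isolated points, so it consists
    of isolated real points and isolated spheres (sym_core_isolated).

    On a sphere contained in T, multiplication on the left by the two coefficients
    of the formula turns a power of z - (x + y I), or of z - (x + y J), into the
    same power on the slice of K. The Laurent coefficient of order -n at x + y K is
    therefore A_n + K B_n with A_n and B_n independent of K. For the largest n > 0
    with (A_n, B_n) <> (0, 0) it vanishes for at most one K: all points of the sphere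
    have order n but possibly that one (sphere_orders). If there is no such n, all
    orders are 0.

    The analytic input is the identity theorem (identity_off_discrete) for
    functions h of x + y K that are only assumed differentiable. It is obtained
    without Cauchy's formula. Goursat's bisection gives h a primitive F
    (holo_potential). Since F has two derivatives in each variable, the maximum
    principle for |F|^2 |z - c|^-2n follows from the second derivative test
    (weighted_no_local_max), and letting n grow shows that a function vanishing near
    the centre of a square vanishes on the square of half the side
    (holo_zero_spread). Vanishing on the real axis is reduced to this case by
    replacing h by 0 on one side of the axis (holo_zero_above). *)

Set Implicit Arguments.
Unset Strict Implicit.
Unset Printing Implicit Defensive.

Import Order.TTheory GRing.Theory Num.Theory.
Import numFieldNormedType.Exports.

Local Open Scope classical_set_scope.
Local Open Scope ring_scope.

(** * Expansions and increments of functions of real variables *)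

Lemma is_derive_epsP (R : realType) (V : normedModType R)
    (f : R -> V) (x : R) (d : V) :
  is_derive x 1 f d <->
  forall e : R, 0 < e -> exists2 del : R, 0 < del &
    forall t, `|t - x| < del -> `|f t - f x - (t - x) *: d| <= e * `|t - x|.
Proof.
split.
- move=> fd e e0.
  have dfx : derivable f x 1 by exact: ex_derive.
  have <- : 'D_1 f x = d by exact: derive_val.
  move/cvgr_dist_le : dfx => /(_ e e0); rewrite -/(derive f x 1).
  case=> del /= del0 H; exists del => // t tx.
  have [->|tnx] := eqVneq t x; first by rewrite !subrr scale0r subr0 !normr0 mulr0.
  have tx0 : t - x != 0 by rewrite subr_eq0.
  have tx' : `|0 - (t - x)| < del by rewrite sub0r normrN.
  have := H (t - x) tx' tx0.
  rewrite /= [_%:A]mulr1 subrK => h.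
  have -> : f t - f x - (t - x) *: 'D_1 f x
      = - ((t - x) *: ('D_1 f x - (t - x)^-1 *: (f t - f x))).
    by rewrite scalerBr scalerA mulfV// scale1r opprB.
  by rewrite normrN normrZ mulrC ler_wpM2r.
- move=> H.
  have C : (fun h : R => h^-1 *: (f (h *: (1 : R) + x) - f x)) @ 0^' --> d.
    apply/cvgrPdist_le => e e0; have [del del0 He] := H e e0.
    exists del => //= h hd0 h0.
    have hd : `|h| < del by move: hd0; rewrite /ball_ /= sub0r normrN.
    have := He (h + x); rewrite addrK => /(_ hd).
    rewrite /= [_%:A]mulr1 => h1.
    have -> : d - h^-1 *: (f (h + x) - f x)
      = - (h^-1 *: (f (h + x) - f x - h *: d)).
      by rewrite [in RHS]scalerBr scalerA mulVf// scale1r opprB.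
    rewrite normrN normrZ normfV mulrC ler_pdivrMr ?normr_gt0//.
  have D : derivable f x 1 by apply/cvg_ex; exists d; exact: C.
  apply: DeriveDef => //; exact: (cvg_lim (@norm_hausdorff _ _) C).
Qed.

Section Increments.
Variable R : realType.
Implicit Types (x y a b l m e del rho : R) (P Q : R -> R -> R).

(** The form of the mean value theorem used throughout: closed segments make
    degenerate ones harmless, and no intermediate point is exhibited. *)
Lemma increment_le (F f : R -> R) a b C : a <= b ->
  (forall x, a <= x <= b -> is_derive x 1 F (f x)) ->
  (forall x, a <= x <= b -> `|f x| <= C) -> `|F b - F a| <= C * (b - a).
Proof.
move=> ab dF fC.
have dF' x : x \in `]a, b[%R -> is_derive x 1 F (f x).
  by rewrite in_itv/= => /andP[/ltW ax /ltW xb]; apply: dF; rewrite ax.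
have cF : {within `[a, b], continuous F}.
  apply: derivable_within_continuous => x; rewrite in_itv/= => /dF h.
  exact: ex_derive.
have [c] := MVT_segment ab dF' cF; rewrite in_itv/= => /fC fc ->.
by rewrite normrM (ger0_norm (_ : 0 <= b - a)) ?subr_ge0// ler_wpM2r ?subr_ge0.
Qed.

Lemma antiderivative (f : R -> R) l m :
  (forall x, l <= x <= m -> {for x, continuous f}) ->
  exists F : R -> R, forall x, l < x < m -> is_derive x 1 F (f x).
Proof.
move=> cf.
have cw : {within `[l, m], continuous f}.
  apply: continuous_in_subspaceT => x; rewrite inE/= in_itv/=; exact: cf.
have fint := continuous_compact_integrable (@segment_compact _ l m) cw.
pose F x := (\int[lebesgue_measure]_(t in [set` `[l, x]]) (f t))%R.
exists F => x /andP[lx xm].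
have cfx : {for x, continuous f} by apply: cf; rewrite !ltW.
have [d dE] := continuous_FTC1_closed xm fint lx cfx.
by rewrite -dE derive1E; apply/derivableP.
Qed.

(** Differentiability at one point, kept in explicit form because Goursat's
    argument evaluates the expansion on rectangles around that point and uses no
    continuity of the partial derivatives. *)
Definition diff2 (V : normedModType R) (P : R -> R -> V) x y (A B : V) := forall e, 0 < e -> exists2 del, 0 < del &
  forall x' y', `|x' - x| < del -> `|y' - y| < del ->
    `|P x' y' - P x y - (x' - x) *: A - (y' - y) *: B|
      <= e * (`|x' - x| + `|y' - y|).

Definition box a b rho x y := `|x - a| < rho /\ `|y - b| < rho.

End Increments.

(** * Circulation along small rectangles *)

Section SmallRectangles.
Variable R : realType.
Implicit Types (x y a b l m e del rho : R) (P Q Phi Psi : R -> R -> R).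

Lemma diff2_swap (V : normedModType R) (P : R -> R -> V) x y A B :
  diff2 P x y A B -> diff2 (fun s t => P t s) y x B A.
Proof.
move=> D e /D[del del0 H]; exists del => // x' y' hx hy.
by have := H _ _ hy hx; rewrite addrAC [X in e * X]addrC.
Qed.

Lemma is_derive_quadratic (u v x t : R) :
  is_derive t 1 (fun s : R => u * s + v / 2 * (s - x) ^+ 2) (u + v * (t - x)).
Proof.
apply/is_derive_epsP => e e0; exists (2 * e / (`|v| + 1)) => [|s st].
  by rewrite divr_gt0 ?mulr_gt0// ltr_wpDl.
rewrite [X in `|X| <= _](_ : _ = v / 2 * (s - t) * (s - t)); last first.
  by rewrite /GRing.scale/=; field.
rewrite normrM ler_wpM2r// normrM.
move: st; rewrite ltr_pdivlMr ?ltr_wpDl// normrM [`|2^-1|]gtr0_norm ?invr_gt0//.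
have : 0 <= `|s - t| by []. have : 0 <= `|v| by [].
nra.
Qed.

(** The increment of Phi is the integral of P along a horizontal side; the affine
    part of P is integrated exactly. *)
Lemma side_expansion P Phi x y (A B : R) : diff2 P x y A B ->
  forall e, 0 < e -> exists2 del, 0 < del & forall a l m t,
    0 <= l < del -> m < del -> a <= x <= a + l -> `|t - y| <= m ->
    (forall s, a <= s <= a + l -> is_derive s 1 (Phi^~ t) (P s t)) ->
    `|Phi (a + l) t - Phi a t -
      (P x y * l + A / 2 * ((a + l - x) ^+ 2 - (a - x) ^+ 2) + B * (t - y) * l)|
      <= e * (l + m) * l.
Proof.
move=> D e e0; have [del del0 H] := D e e0; exists del => //.
move=> a l m t /andP[l0 ld] md /andP[ax xl] ty dPhi.
pose u := P x y + B * (t - y).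
pose G s := Phi s t - (u * s + A / 2 * (s - x) ^+ 2).
have dG s : a <= s <= a + l -> is_derive s 1 G (P s t - (u + A * (s - x))).
  by move=> /dPhi h; apply: is_deriveB; exact: is_derive_quadratic.
have bG s : a <= s <= a + l -> `|P s t - (u + A * (s - x))| <= e * (l + m).
  move=> /andP[as_ sl].
  have sx : `|s - x| <= l by rewrite ler_norml; apply/andP; split; lra.
  have -> : P s t - (u + A * (s - x)) = P s t - P x y - (s - x) *: A - (t - y) *: B.
    by rewrite /u /GRing.scale/=; ring.
  apply: le_trans (H s t _ _) _; [lra|lra|].
  by rewrite ler_wpM2l ?(ltW e0)// lerD.
have al : a <= a + l by lra.
have := increment_le al dG bG.
have -> : a + l - a = l by ring.
have -> // : G (a + l) - G a = Phi (a + l) t - Phi a t -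
  (P x y * l + A / 2 * ((a + l - x) ^+ 2 - (a - x) ^+ 2) + B * (t - y) * l).
by rewrite /G /u; ring.
Qed.

(** The circulation of P dx + Q dy along the boundary of the rectangle with
    opposite corners (a, c) and (b, d), when Phi and Psi are antiderivatives of
    P in the first and of Q in the second variable. *)
Definition circulation Phi Psi a c b d : R :=
  (Phi b c - Phi a c) - (Phi b d - Phi a d)
  + (Psi b d - Psi b c) - (Psi a d - Psi a c).

(** The affine part of the form has circulation (dQ/dx - dP/dy) times the area,
    which is zero; only the remainders on the four sides are left. *)
Lemma circulation_small P Q Phi Psi x y (A B C : R) :
  diff2 P x y A B -> diff2 Q x y B C ->
  forall e, 0 < e -> exists2 del, 0 < del & forall a c l m,
    0 <= l < del -> 0 <= m < del -> a <= x <= a + l -> c <= y <= c + m ->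
    (forall s t, a <= s <= a + l -> c <= t <= c + m ->
      is_derive s 1 (Phi^~ t) (P s t) /\ is_derive t 1 (Psi s) (Q s t)) ->
    `|circulation Phi Psi a c (a + l) (c + m)| <= e * (l + m) ^+ 2.
Proof.
move=> DP DQ e e0.
have e20 : 0 < e / 2 by lra.
have [d1 d10 H1] := side_expansion Phi DP e20.
have [d2 d20 H2] := side_expansion (fun s t => Psi t s) (diff2_swap DQ) e20.
exists (Num.min d1 d2); first by rewrite lt_min d10.
move=> a c l m; rewrite !lt_min => /and3P[l0 l1 l2] /and3P[m0 m1 m2] ax cy dPhi.
have [/andP[ax1 ax2] /andP[cy1 cy2]] := (ax, cy).
have bc : c <= c <= c + m by lra.
have bd : c <= c + m <= c + m by lra.
have ba : a <= a <= a + l by lra.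
have bb : a <= a + l <= a + l by lra.
have n1 : `|c - y| <= m by rewrite ler_norml; apply/andP; split; lra.
have n2 : `|c + m - y| <= m by rewrite ler_norml; apply/andP; split; lra.
have n3 : `|a - x| <= l by rewrite ler_norml; apply/andP; split; lra.
have n4 : `|a + l - x| <= l by rewrite ler_norml; apply/andP; split; lra.
have ll : 0 <= l < d1 by rewrite l0.
have mm : 0 <= m < d2 by rewrite m0.
have h1 := H1 a l m c ll m1 ax n1 (fun s hs => (dPhi s c hs bc).1).
have h2 := H1 a l m (c + m) ll m1 ax n2 (fun s hs => (dPhi s (c + m) hs bd).1).
have h3 := H2 c m l a mm l2 cy n3 (fun t ht => (dPhi a t ba ht).2).
have h4 := H2 c m l (a + l) mm l2 cy n4 (fun t ht => (dPhi (a + l) t bb ht).2).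
move: h1 h2 h3 h4; rewrite !ler_norml.
move=> /andP[p1 p2] /andP[q1 q2] /andP[r1 r2] /andP[s1 s2].
have -> : e * (l + m) ^+ 2
  = 2 * (e / 2 * (l + m) * l) + 2 * (e / 2 * (m + l) * m) by field.
rewrite /circulation; apply/andP; split; lra.
Qed.

End SmallRectangles.

(** * Goursat's lemma *)

Section Goursat.
Variable R : realType.
Implicit Types (x y a b l m e del rho : R) (P Q Phi Psi : R -> R -> R).

Lemma nested_intervals (u l : nat -> R) : (forall n, 0 <= l n) ->
  (forall n, u n <= u n.+1) -> (forall n, u n.+1 + l n.+1 <= u n + l n) ->
  exists x, forall n, u n <= x <= u n + l n.
Proof.
move=> l0 um vm.
have um' i j : u i <= u (i + j)%N.
  by elim: j => [|j ih]; rewrite ?addn0// addnS (le_trans ih).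
have vm' i j : u (i + j)%N + l (i + j)%N <= u i + l i.
  by elim: j => [|j ih]; rewrite ?addn0// addnS (le_trans _ ih).
have ub n : ubound (range u) (u n + l n).
  move=> _ [k _ <-]; apply: le_trans (um' k n) _; rewrite addnC.
  by apply: le_trans _ (vm' n k); rewrite lerDl.
exists (sup (range u)) => n; apply/andP; split.
  by apply: ub_le_sup; [exists (u 0%N + l 0%N)|exists n].
by apply: ge_sup; [exists (u 0%N); exists 0%N|].
Qed.

Lemma dyadic_small a del : 0 < del -> exists n, a / 2 ^+ n < del.
Proof.
move=> del0; have [n] : exists n, a / del < n%:R.
  by exists (Num.truncn (a / del)).+1; exact: truncnS_gt.
move=> an; exists n; rewrite ltr_pdivrMr ?exprn_gt0//.
rewrite ltr_pdivrMr// in an; apply: lt_le_trans an _; rewrite mulrC ler_pM2l//.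
by rewrite -natrX ler_nat ltnW// ltn_expl.
Qed.

Lemma le0_of_le_eps a b : 0 <= b -> (forall e, 0 < e -> a <= e * b) -> a <= 0.
Proof.
move=> b0 H; rewrite leNgt; apply/negP => a0.
have b1 : 0 < b + 1 by lra.
have := H (a / (b + 1) / 2); rewrite !divr_gt0// => /(_ isT).
rewrite leNgt => /negP; apply.
rewrite mulrAC ltr_pdivrMr// mulrAC ltr_pdivrMr//; nra.
Qed.

(** Goursat's bisection: one of the four quarters carries at least a quarter of
    the circulation, so the nested rectangles shrink to a point where the
    first-order expansion makes the circulation negligible against the area. *)
Lemma circulation_eq0 P Q Phi Psi a c l m : 0 <= l -> 0 <= m ->
  (forall s t, a <= s <= a + l -> c <= t <= c + m ->
     exists A B C : R, diff2 P s t A B /\ diff2 Q s t B C) ->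
  (forall s t, a <= s <= a + l -> c <= t <= c + m ->
     is_derive s 1 (Phi^~ t) (P s t) /\ is_derive t 1 (Psi s) (Q s t)) ->
  circulation Phi Psi a c (a + l) (c + m) = 0.
Proof.
move=> l0 m0 PQ dPQ.
pose lw n := l / 2 ^+ n; pose mw n := m / 2 ^+ n.
have p2 n : 0 < 2 ^+ n :> R by exact: exprn_gt0.
have lw0 n : 0 <= lw n by apply: divr_ge0 => //; exact: ltW.
have mw0 n : 0 <= mw n by apply: divr_ge0 => //; exact: ltW.
have lwS n : lw n = 2 * lw n.+1 by rewrite /lw exprS; field; rewrite gt_eqF.
have mwS n : mw n = 2 * mw n.+1 by rewrite /mw exprS; field; rewrite gt_eqF.
pose J n (p : R * R) := circulation Phi Psi p.1 p.2 (p.1 + lw n) (p.2 + mw n).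
have quarter (z : nat * (R * R)) : exists p' : R * R,
  [/\ z.2.1 <= p'.1 <= z.2.1 + lw z.1.+1, z.2.2 <= p'.2 <= z.2.2 + mw z.1.+1
    & `|J z.1 z.2| <= 4 * `|J z.1.+1 p'|].
  case: z => n [u v] /=; have := lw0 n.+1; have := mw0 n.+1.
  set l' := lw n.+1; set m' := mw n.+1 => hm hl.
  have E : J n (u, v) = J n.+1 (u, v) + J n.+1 (u + l', v)
      + J n.+1 (u, v + m') + J n.+1 (u + l', v + m').
    rewrite /J /= lwS mwS -/l' -/m' /circulation.
    have -> : u + 2 * l' = u + l' + l' by ring.
    have -> : v + 2 * m' = v + m' + m' by ring.
    by ring.
  have hu : u <= u <= u + l' by lra.
  have hu' : u <= u + l' <= u + l' by lra.
  have hv : v <= v <= v + m' by lra.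
  have hv' : v <= v + m' <= v + m' by lra.
  have [h1|h1] := leP `|J n (u, v)| (4 * `|J n.+1 (u, v)|); first by exists (u, v).
  have [h2|h2] := leP `|J n (u, v)| (4 * `|J n.+1 (u + l', v)|).
    by exists (u + l', v).
  have [h3|h3] := leP `|J n (u, v)| (4 * `|J n.+1 (u, v + m')|).
    by exists (u, v + m').
  have [h4|h4] := leP `|J n (u, v)| (4 * `|J n.+1 (u + l', v + m')|).
    by exists (u + l', v + m').
  exfalso; suff : `|J n (u, v)| <= `|J n.+1 (u, v)| + `|J n.+1 (u + l', v)|
      + `|J n.+1 (u, v + m')| + `|J n.+1 (u + l', v + m')| by lra.
  rewrite E; set j1 := J _ (u, v); set j2 := J _ _; set j3 := J _ _; set j4 := J _ _.
  have := ler_normD (j1 + j2 + j3) j4; have := ler_normD (j1 + j2) j3.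
  by have := ler_normD j1 j2; lra.
have [nxt nxtP] := choice quarter.
pose p := fix p n := if n is n'.+1 then nxt (n', p n') else (a, c).
have pS n := nxtP (n, p n); have {}pS n : [/\ (p n).1 <= (p n.+1).1 <= (p n).1 + lw n.+1,
  (p n).2 <= (p n.+1).2 <= (p n).2 + mw n.+1 & `|J n (p n)| <= 4 * `|J n.+1 (p n.+1)|].
  exact: pS.
have [x xP] : exists x, forall n, (p n).1 <= x <= (p n).1 + lw n.
  apply: nested_intervals => // n; have [/andP[h1 h2] _ _] := pS n => //.
  by have := lwS n; lra.
have [y yP] : exists y, forall n, (p n).2 <= y <= (p n).2 + mw n.
  apply: nested_intervals => // n; have [_ /andP[h1 h2] _] := pS n => //.
  by have := mwS n; lra.
have inrect n s t : (p n).1 <= s <= (p n).1 + lw n -> (p n).2 <= t <= (p n).2 + mw n ->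
    a <= s <= a + l /\ c <= t <= c + m.
  elim: n s t => [|n ih] s t; first by rewrite /lw /mw expr0 !divr1.
  have [/andP[h1 h2] /andP[h3 h4] _] := pS n.
  move=> /andP[s1 s2] /andP[t1 t2]; have := lwS n; have := mwS n => h5 h6.
  by apply: ih; apply/andP; split; lra.
have J0 n : `|J 0%N (p 0%N)| <= 4 ^+ n * `|J n (p n)|.
  elim: n => [|n ih]; first by rewrite expr0 mul1r.
  apply: le_trans ih _; rewrite exprSr -mulrA ler_wpM2l ?exprn_ge0//.
  by have [] := pS n.
have [ax cy] := inrect _ _ _ (xP 0%N) (yP 0%N).
have [A [B [C [DP DQ]]]] := PQ _ _ ax cy.
have -> : circulation Phi Psi a c (a + l) (c + m) = J 0%N (p 0%N).
  by rewrite /J /lw /mw /= expr0 !divr1.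
apply/eqP; rewrite -normr_le0; apply: (@le0_of_le_eps _ ((l + m) ^+ 2)).
  by rewrite sqr_ge0.
move=> e e0; have [del del0 H] := circulation_small Phi Psi DP DQ e0.
have [n1 nl] := dyadic_small l del0; have [n2 nm] := dyadic_small m del0.
pose n := (n1 + n2)%N.
have ln : lw n < del.
  apply: le_lt_trans nl; rewrite /lw exprD ler_wpM2l// lef_pV2 ?posrE ?mulr_gt0//.
  by rewrite ler_peMr ?(ltW (p2 _))// exprn_ege1// ler1n.
have mn : mw n < del.
  apply: le_lt_trans nm; rewrite /mw exprD ler_wpM2l// lef_pV2 ?posrE ?mulr_gt0//.
  by rewrite ler_peMl ?(ltW (p2 _))// exprn_ege1// ler1n.
have h : `|J n (p n)| <= e * (lw n + mw n) ^+ 2.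
  apply: H; rewrite ?lw0 ?mw0 ?ln ?mn//.
  by move=> s t hs ht; have [hs' ht'] := inrect _ _ _ hs ht; exact: dPQ.
apply: le_trans (J0 n) _.
have q0 : 0 < 4 ^+ n :> R by rewrite exprn_gt0.
rewrite mulrC -ler_pdivlMr//; apply: le_trans h _.
have -> : 4 ^+ n = 2 ^+ n * 2 ^+ n :> R by rewrite -exprMn; congr (_ ^+ _); ring.
rewrite le_eqVlt; apply/orP; left; apply/eqP; rewrite /lw /mw.
by field; rewrite gt_eqF.
Qed.

End Goursat.

(** * Potentials and the second derivative test *)

Lemma is_derive_local (R : realType) (V : normedModType R)
    (f g : R -> V) (x : R) (d : V) (r : R) :
  0 < r -> (forall t, `|t - x| < r -> f t = g t) ->
  is_derive x 1 f d -> is_derive x 1 g d.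
Proof.
move=> r0 fg /is_derive_epsP df; apply/is_derive_epsP => e /df[del del0 H].
exists (Num.min r del) => [|t]; first by rewrite lt_min r0.
by rewrite lt_min => /andP[tr td]; rewrite -!fg ?subrr ?normr0//; exact: H.
Qed.

Lemma is_derive_unique (R : realType) (V : normedModType R)
    (f : R -> V) (x : R) (c d : V) :
  is_derive x 1 f c -> is_derive x 1 f d -> c = d.
Proof. by move=> fc fd; rewrite -(@derive_val _ _ _ _ _ _ _ fc) derive_val. Qed.

Lemma derive_locally_zero (R : realType) (V : normedModType R) (f : R -> V)
    (x : R) (d : V) (r : R) :
  0 < r -> (forall t, `|t - x| < r -> f t = 0) -> is_derive x 1 f d -> d = 0.
Proof.
move=> r0 f0 fd; apply: (is_derive_unique fd).
by apply: (@is_derive_local _ _ (cst (0 : V)) f x 0 r r0) => t /f0 ->.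
Qed.

Section Potentials.
Variable R : realType.
Implicit Types (x y a b l m e del rho : R) (P Q Phi Psi : R -> R -> R).

Lemma diff2_derive (V : normedModType R) (P : R -> R -> V) x y A B :
  diff2 P x y A B -> is_derive x 1 (P^~ y) A.
Proof.
move=> D; apply/is_derive_epsP => e /D[del del0 H]; exists del => // t tx.
by have := H t y tx; rewrite subrr normr0 scale0r subr0 addr0; exact.
Qed.

Lemma circulationNl Phi Psi a c b d :
  circulation Phi Psi b c a d = - circulation Phi Psi a c b d.
Proof. by rewrite /circulation; ring. Qed.

Lemma circulationNr Phi Psi a c b d :
  circulation Phi Psi a d b c = - circulation Phi Psi a c b d.
Proof. by rewrite /circulation; ring. Qed.

(** Going from the centre to (x, y) along two sides of a rectangle gives the same
    value in either order, since the circulation vanishes; one order exhibits the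
    derivative in y, the other the derivative in x. The smaller radius leaves
    room for the antiderivatives, which live on closed segments. *)
Lemma potential P Q a b rho rho' : 0 < rho' < rho ->
  (forall x y, box a b rho x y ->
    exists A B C : R, diff2 P x y A B /\ diff2 Q x y B C) ->
  exists F : R -> R -> R, forall x y, box a b rho' x y ->
    is_derive x 1 (F^~ y) (P x y) /\ is_derive y 1 (F x) (Q x y).
Proof.
move=> /andP[r0 rr] PQ.
have nl x c : c - rho' <= x <= c + rho' -> `|x - c| < rho.
  by move=> /andP[h1 h2]; rewrite ltr_norml; apply/andP; split; lra.
have cont (f : R -> R) x d : is_derive x 1 f d -> {for x, continuous f}.
  by move=> ?; apply/differentiable_continuous/derivable1_diffP/ex_derive.
have /choice[Phi PhiP] y : exists G : R -> R, `|y - b| < rho ->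
    forall x, a - rho' < x < a + rho' -> is_derive x 1 G (P x y).
  have [yb|yb] := pselect (`|y - b| < rho); last by exists (fun=> 0).
  have [x /nl xa|G GP] := @antiderivative _ (P^~ y) (a - rho') (a + rho').
    by have [A [B [C [/diff2_derive + _]]]] := PQ x y (conj xa yb); exact: cont.
  by exists G.
have /choice[Psi PsiP] x : exists G : R -> R, `|x - a| < rho ->
    forall y, b - rho' < y < b + rho' -> is_derive y 1 G (Q x y).
  have [xa|xa] := pselect (`|x - a| < rho); last by exists (fun=> 0).
  have [y /nl yb|G GP] := @antiderivative _ (Q x) (b - rho') (b + rho').
    have [A [B [C [_ /diff2_swap/diff2_derive]]]] := PQ x y (conj xa yb).
    exact: cont.
  by exists G.
pose F x y := Phi b x - Phi b a + (Psi x y - Psi x b).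
exists F.
have dPQ s t : box a b rho' s t -> is_derive s 1 (Phi t) (P s t) /\
    is_derive t 1 (Psi s) (Q s t).
  rewrite /box !ltr_norml => -[/andP[h1 h2] /andP[h3 h4]].
  split; [apply: PhiP|apply: PsiP]; rewrite ?ltr_norml; apply/andP; split; lra.
have bb x y : box a b rho' x y -> circulation (fun s t => Phi t s) Psi a b x y = 0.
  have oriented c d x' y' : c <= x' -> d <= y' -> box a b rho' x' y' -> box a b rho' c d ->
      circulation (fun s t => Phi t s) Psi c d x' y' = 0.
    rewrite /box !ltr_norml => cx dy [/andP[h1 h2] /andP[h3 h4]] [/andP[h5 h6] /andP[h7 h8]].
    have -> : x' = c + (x' - c) by ring.
    have -> : y' = d + (y' - d) by ring.
    have hb s t : c <= s <= c + (x' - c) -> d <= t <= d + (y' - d) -> box a b rho' s t.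
      rewrite /box !ltr_norml => /andP[g1 g2] /andP[g3 g4].
      by split; apply/andP; split; lra.
    apply: (@circulation_eq0 _ P Q); rewrite ?subr_ge0// => s t hs ht.
      have [u v] := hb s t hs ht; apply: PQ; split; exact: lt_trans rr.
    exact: dPQ (hb s t hs ht).
  move=> [xa yb].
  have [ax|ax] := leP a x; have [by_|by_] := leP b y.
  - by apply: oriented => //; rewrite /box ?subrr ?normr0.
  - apply/eqP; rewrite -[X in X == _]opprK -circulationNr oppr_eq0; apply/eqP.
    by apply: oriented => //; rewrite ?ltW// /box ?subrr ?normr0.
  - apply/eqP; rewrite -[X in X == _]opprK -circulationNl oppr_eq0; apply/eqP.
    by apply: oriented => //; rewrite ?ltW// /box ?subrr ?normr0.
  - rewrite -[LHS]opprK -circulationNl -circulationNr.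
    by apply: oriented => //; rewrite ?ltW// /box ?subrr ?normr0.
move=> x y [xa yb]; split.
- have d0 : 0 < rho' - `|x - a| by lra.
  pose G s := (Psi a y - Psi a b - Phi y a) + Phi y s.
  apply: (@is_derive_local _ _ G _ _ _ _ d0) => [s sx|].
    have sa : `|s - a| < rho' by have := ler_distD x s a; lra.
    by have := bb s y (conj sa yb); rewrite /circulation /G /F; lra.
  rewrite /G -[P x y]add0r; apply: is_deriveD; exact: (dPQ _ _ (conj xa yb)).1.
- rewrite -[Q x y]addr0 /F.
  have -> : (fun t => Phi b x - Phi b a + (Psi x t - Psi x b)) =
     Psi x + cst (Phi b x - Phi b a - Psi x b).
    by apply/funext => t; rewrite !fctE; ring.
  apply: is_deriveD; exact: (dPQ _ _ (conj xa yb)).2.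
Qed.

(** The derivative psi vanishes at the maximum, so m > 0 would make phi increase
    just to the right of it. *)
Lemma second_derivative_le0 (phi psi : R -> R) x r m : 0 < r ->
  (forall t, `|t - x| < r -> is_derive t 1 phi (psi t)) ->
  is_derive x 1 psi m ->
  (forall t, `|t - x| < r -> phi t <= phi x) -> m <= 0.
Proof.
move=> r0 dphi dpsi pmax; rewrite leNgt; apply/negP => m0.
have inr t : t \in `](x - r), (x + r)[ -> `|t - x| < r.
  by rewrite in_itv/= ltr_norml => /andP[h1 h2]; apply/andP; split; lra.
have psi0 : psi x = 0.
  apply: (@is_derive_unique _ _ phi x); first by apply: dphi; rewrite subrr normr0.
  apply: (@derive1_at_max _ phi (x - r) (x + r)); first lra.
  - by move=> t /inr/dphi h; exact: ex_derive.
  - by rewrite in_itv/=; apply/andP; split; lra.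
  - by move=> t /inr; exact: pmax.
have m20 : 0 < m / 2 by lra.
have [del del0 H] := (is_derive_epsP _ _ _).1 dpsi _ m20.
pose k := Num.min r del / 2.
have k0 : 0 < k by rewrite divr_gt0// lt_min r0.
have mr : Num.min r del <= r by rewrite ge_min lexx.
have md : Num.min r del <= del by rewrite ge_min lexx orbT.
have kr : k < r by rewrite /k; lra.
have kd : k < del by rewrite /k; lra.
have nt t : x <= t <= x + k -> `|t - x| = t - x.
  by move=> /andP[h _]; rewrite ger0_norm ?subr_ge0.
have dphi' t : x <= t <= x + k -> is_derive t 1 phi (psi t).
  by move=> ht; apply: dphi; rewrite nt//; lra.
have [|t||c] := @MVT _ phi psi x (x + k).
- by rewrite ltrDl.
- by rewrite in_itv/= => /andP[h1 h2]; apply: dphi'; rewrite !ltW.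
- apply: derivable_within_continuous => t; rewrite in_itv/= => /dphi' h.
  exact: ex_derive.
rewrite in_itv/= => /andP[c1 c2] E.
have cc : x <= c <= x + k by rewrite !ltW.
have cd : c - x < del by lra.
have := H c; rewrite nt// psi0 subr0 => /(_ cd).
rewrite /GRing.scale/= ler_norml => /andP[h1 h2].
have cm : 0 < (c - x) * m by rewrite mulr_gt0// subr_gt0.
have pc : 0 < psi c by lra.
have := pmax (x + k); rewrite addrAC subrr add0r gtr0_norm// => /(_ kr).
by rewrite -subr_le0 E addrAC subrr add0r leNgt mulr_gt0.
Qed.

End Potentials.

(** * Quaternions and holomorphy on a slice *)

Section QuatBasics.
Variable R : realType.
Local Notation H := (quat R).
Implicit Types (p q I J K A B : H) (x y a b e rho : R) (F G h : R -> R -> H).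

Lemma quat_eqP p q : qr p = qr q -> qi p = qi q -> qj p = qj q -> qk p = qk q -> p = q.
Proof. by case: p q => [????] [????] /= -> -> -> ->. Qed.

Lemma qnorm_sqr q : `|q| ^+ 2 = qsqnorm q.
Proof. by rewrite sqr_sqrtr// qsqnorm_ge0. Qed.

Lemma qnormM p q : `|p * q| = `|p| * `|q|.
Proof.
apply/eqP; rewrite -(@eqrXn2 _ 2)// ?mulr_ge0// exprMn !qnorm_sqr.
by apply/eqP; rewrite /qsqnorm/=; ring.
Qed.

Definition qdot p q : R := qr p * qr q + qi p * qi q + qj p * qj q + qk p * qk q.

Lemma qdotqq q : qdot q q = `|q| ^+ 2.
Proof. by rewrite qnorm_sqr /qdot /qsqnorm !expr2. Qed.

(** What is used of the four real coordinates, so that each argument is made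
    once. *)
Definition is_coord (pr : H -> R) := [/\ forall p q, pr (p + q) = pr p + pr q,
  forall a q, pr (a *: q) = a * pr q & forall q, `|pr q| <= `|q|].

Lemma sqr_le_norm a q : a ^+ 2 <= qsqnorm q -> `|a| <= `|q|.
Proof. by move=> aq; rewrite -(@ler_pXn2r _ 2) ?nnegrE// qnorm_sqr real_normK ?num_real. Qed.

Lemma coord_qr : is_coord (@qr R).
Proof.
split => // q; apply: sqr_le_norm; rewrite /qsqnorm.
have := sqr_ge0 (qr q); have := sqr_ge0 (qi q); have := sqr_ge0 (qj q).
by have := sqr_ge0 (qk q); lra.
Qed.

Lemma coord_qi : is_coord (@qi R).
Proof.
split => // q; apply: sqr_le_norm; rewrite /qsqnorm.
have := sqr_ge0 (qr q); have := sqr_ge0 (qi q); have := sqr_ge0 (qj q).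
by have := sqr_ge0 (qk q); lra.
Qed.

Lemma coord_qj : is_coord (@qj R).
Proof.
split => // q; apply: sqr_le_norm; rewrite /qsqnorm.
have := sqr_ge0 (qr q); have := sqr_ge0 (qi q); have := sqr_ge0 (qj q).
by have := sqr_ge0 (qk q); lra.
Qed.

Lemma coord_qk : is_coord (@qk R).
Proof.
split => // q; apply: sqr_le_norm; rewrite /qsqnorm.
have := sqr_ge0 (qr q); have := sqr_ge0 (qi q); have := sqr_ge0 (qj q).
by have := sqr_ge0 (qk q); lra.
Qed.

Hint Resolve coord_qr coord_qi coord_qj coord_qk : core.

Lemma coordN pr q : is_coord pr -> pr (- q) = - pr q.
Proof. by case=> _ hZ _; rewrite -scaleN1r hZ mulN1r. Qed.

Lemma coordB pr p q : is_coord pr -> pr (p - q) = pr p - pr q.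
Proof. by move=> c; have [hD _ _] := c; rewrite hD coordN. Qed.

Lemma qnorm_le_coords q : `|q| <= `|qr q| + `|qi q| + `|qj q| + `|qk q|.
Proof.
have E : q = qr q *: (Quat 1 0 0 0) + qi q *: (Quat 0 1 0 0)
            + qj q *: (Quat 0 0 1 0) + qk q *: (Quat 0 0 0 1).
  by apply: quat_eqP => /=; ring.
have n1 (u : H) : qsqnorm u = 1 -> `|u| = 1.
  by move=> u1; apply/eqP; rewrite -sqrp_eq1// qnorm_sqr u1.
rewrite {1}E; apply: le_trans (ler_normD _ _) _; apply: lerD.
  apply: le_trans (ler_normD _ _) _; apply: lerD.
    apply: le_trans (ler_normD _ _) _; apply: lerD.
all: by rewrite normrZ n1 ?mulr1// /qsqnorm/=; ring.
Qed.

Lemma is_derive_coord pr (f : R -> H) (t : R) (d : H) : is_coord pr ->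
  is_derive t 1 f d -> is_derive t 1 (pr \o f) (pr d).
Proof.
move=> c /is_derive_epsP D; have [hD hZ hl] := c; apply/is_derive_epsP => e /D.
case=> del del0 h; exists del => // s st; apply: le_trans (h s st).
by apply: le_trans (hl _); rewrite !coordB// hZ.
Qed.

Lemma is_derive_quat (f : R -> H) (t : R) (d : H) :
  is_derive t 1 (fun s => qr (f s)) (qr d) -> is_derive t 1 (fun s => qi (f s)) (qi d) ->
  is_derive t 1 (fun s => qj (f s)) (qj d) -> is_derive t 1 (fun s => qk (f s)) (qk d) ->
  is_derive t 1 f d.
Proof.
move=> /is_derive_epsP D1 /is_derive_epsP D2 /is_derive_epsP D3 /is_derive_epsP D4.
apply/is_derive_epsP => e e0; have e40 : 0 < e / 4 by rewrite divr_gt0.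
have [d1 d10 h1] := D1 _ e40; have [d2 d20 h2] := D2 _ e40.
have [d3 d30 h3] := D3 _ e40; have [d4 d40 h4] := D4 _ e40.
exists (Num.min (Num.min d1 d2) (Num.min d3 d4)); first by rewrite !lt_min d10 d20 d30.
move=> s; rewrite !lt_min => /andP[/andP[/h1 s1 /h2 s2] /andP[/h3 s3 /h4 s4]].
apply: le_trans (qnorm_le_coords _) _.
move: s1 s2 s3 s4; rewrite /GRing.scale /=; lra.
Qed.

Lemma is_derive_qdot (f g : R -> H) (t : R) (df dg : H) :
  is_derive t 1 f df -> is_derive t 1 g dg ->
  is_derive t 1 (fun s => qdot (f s) (g s)) (qdot df (g t) + qdot (f t) dg).
Proof.
move=> Df Dg.
have M pr : is_coord pr -> is_derive t 1 (fun s => pr (f s) * pr (g s))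
    (pr (f t) * pr dg + pr (g t) * pr df).
  by move=> c; apply: is_deriveM; exact: is_derive_coord.
have -> : qdot df (g t) + qdot (f t) dg =
   (qr (f t) * qr dg + qr (g t) * qr df) + (qi (f t) * qi dg + qi (g t) * qi df)
 + (qj (f t) * qj dg + qj (g t) * qj df) + (qk (f t) * qk dg + qk (g t) * qk df).
  by rewrite /qdot; ring.
apply: is_deriveD; last exact: M.
apply: is_deriveD; last exact: M.
by apply: is_deriveD; exact: M.
Qed.

Lemma diff2_coord pr h x y (A B : H) : is_coord pr ->
  diff2 h x y A B -> diff2 (fun s t => pr (h s t)) x y (pr A) (pr B).
Proof.
move=> c D e /D[del del0 h']; have [hD hZ hl] := c; exists del => // x' y' hx hy.
by apply: le_trans (h' _ _ hx hy); apply: le_trans (hl _); rewrite !coordB// !hZ.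
Qed.

Lemma diff2_mull c h x y (A B : H) :
  diff2 h x y A B -> diff2 (fun s t => c * h s t) x y (c * A) (c * B).
Proof.
move=> D e e0; have c0 : 0 < `|c| + 1 by rewrite ltr_wpDl.
have [|del del0 h'] := D (e / (`|c| + 1)); first by rewrite divr_gt0.
exists del => // x' y' hx hy; have := h' _ _ hx hy.
rewrite !scalerAr -!mulrBr qnormM => hh.
apply: le_trans (ler_wpM2l (normr_ge0 c) hh) _.
rewrite mulrA ler_wpM2r ?addr_ge0// mulrCA ler_piMr ?(ltW e0)//.
by rewrite ler_pdivrMr// mul1r lerDl.
Qed.

Lemma diff2D h1 h2 x y (A1 B1 A2 B2 : H) :
  diff2 h1 x y A1 B1 -> diff2 h2 x y A2 B2 ->
  diff2 (fun s t => h1 s t + h2 s t) x y (A1 + A2) (B1 + B2).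
Proof.
move=> D1 D2 e e0; have e20 : 0 < e / 2 by rewrite divr_gt0.
have [d1 d10 h1'] := D1 _ e20; have [d2 d20 h2'] := D2 _ e20.
exists (Num.min d1 d2); first by rewrite lt_min d10.
move=> x' y'; rewrite !lt_min => /andP[x1 x2] /andP[y1 y2].
have := h1' _ _ x1 y1; have := h2' _ _ x2 y2 => i2 i1.
have -> : e * (`|x' - x| + `|y' - y|) =
  e / 2 * (`|x' - x| + `|y' - y|) + e / 2 * (`|x' - x| + `|y' - y|) by field.
apply: le_trans (lerD i1 i2); apply: le_trans (ler_normD _ _).
rewrite le_eqVlt; apply/orP; left; apply/eqP; congr `|_|.
by apply: quat_eqP => /=; ring.
Qed.

(** Holomorphy in the variable x + y K, for the complex structure given by left
    multiplication by K; the planar variable is kept as a pair of reals so that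
    functions on different slices live on the same domain. *)
Definition holo K (D : R -> R -> Prop) h := forall x y, D x y ->
  exists A, diff2 h x y A (K * A).

Lemma holo_sub K (D D' : R -> R -> Prop) h :
  (forall x y, D' x y -> D x y) -> holo K D h -> holo K D' h.
Proof. by move=> DD hh x y /DD; exact: hh. Qed.

Lemma imag_unitP I : imag_units I ->
  qr I = 0 /\ qi I ^+ 2 + qj I ^+ 2 + qk I ^+ 2 = 1.
Proof.
rewrite /imag_units/= expr2; case: I => a b c d /= [] e1 e2 e3 e4.
have a0 : a = 0.
  apply: contrapT => /eqP a0.
  have b0 : b = 0 by apply: (mulfI a0); lra.
  have c0 : c = 0 by apply: (mulfI a0); lra.
  have d0 : d = 0 by apply: (mulfI a0); lra.
  by move: e1; rewrite b0 c0 d0; have := sqr_ge0 a; rewrite expr2; lra.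
by split => //; move: e1; rewrite a0 !expr2; lra.
Qed.

Lemma imag_unit_norm I : imag_units I -> `|I| = 1.
Proof.
move=> /imag_unitP[r0 n1]; apply/eqP; rewrite -sqrp_eq1// qnorm_sqr /qsqnorm r0.
by rewrite expr0n/= add0r n1.
Qed.

Lemma imag_unit_sqr I : imag_units I -> I * I = -1.
Proof. by rewrite /imag_units/= expr2. Qed.

Lemma imag_unitM I q : imag_units I -> I * (I * q) = - q.
Proof. by move=> /imag_unit_sqr e; rewrite mulrA e mulN1r. Qed.

Lemma qdotMr I p q : imag_units I -> qdot p (I * q) = - qdot (I * p) q.
Proof.
move=> /imag_unitP[r0 _]; case: I p q r0 => [????] [????] [????] /= ->.
by rewrite /qdot/=; ring.
Qed.

Lemma holo_potential K h a b rho rho' : imag_units K -> 0 < rho' < rho ->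
  holo K (box a b rho) h -> exists F, forall x y, box a b rho' x y ->
    is_derive x 1 (F^~ y) (h x y) /\ is_derive y 1 (F x) (K * h x y).
Proof.
move=> uK rr hh.
have pot pr : is_coord pr -> exists F : R -> R -> R, forall x y, box a b rho' x y ->
    is_derive x 1 (F^~ y) (pr (h x y)) /\ is_derive y 1 (F x) (pr (K * h x y)).
  move=> c; apply: (@potential _ (fun x y => pr (h x y)) (fun x y => pr (K * h x y))) rr _.
  move=> x y /hh[A D]; exists (pr A), (pr (K * A)), (pr (K * (K * A))).
  by split; [exact: diff2_coord|apply: diff2_coord => //; exact: diff2_mull].
have [F1 P1] := pot _ coord_qr; have [F2 P2] := pot _ coord_qi.
have [F3 P3] := pot _ coord_qj; have [F4 P4] := pot _ coord_qk.
exists (fun x y => Quat (F1 x y) (F2 x y) (F3 x y) (F4 x y)) => x y xy.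
have [p1 q1] := P1 _ _ xy; have [p2 q2] := P2 _ _ xy.
have [p3 q3] := P3 _ _ xy; have [p4 q4] := P4 _ _ xy.
by split; exact: is_derive_quat.
Qed.

End QuatBasics.
#[export] Hint Resolve coord_qr coord_qi coord_qj coord_qk : core.

(** * A weighted maximum principle *)

Section Carleman.
Variable R : realType.
Local Notation H := (quat R).
Implicit Types (p q I J K A B : H) (x y a b c e r rho : R) (F G h : R -> R -> H).

Lemma is_derive_affine_sqr a c (t : R) :
  is_derive t 1 (fun s => (s - a) ^+ 2 + c) (2 * (t - a)).
Proof.
have -> : (fun s => (s - a) ^+ 2 + c) =
  (fun s : R => 0 * s + 2 / 2 * (s - a) ^+ 2) + cst c.
  by apply/funext => s; rewrite !fctE; field.
rewrite -[2 * (t - a)]addr0; apply: is_deriveD.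
by rewrite -[2 * (t - a)]add0r; exact: is_derive_quadratic.
Qed.

Lemma is_derive_inv_pow a c (t : R) n : 0 < (t - a) ^+ 2 + c ->
  is_derive t 1 (fun s => ((s - a) ^+ 2 + c)^-1 ^+ n)
    (- (2 * n%:R) * (t - a) * ((t - a) ^+ 2 + c)^-1 ^+ n.+1).
Proof.
move=> w0; set w := (t - a) ^+ 2 + c.
have wn0 : w != 0 by rewrite gt_eqF.
have D1 : is_derive t 1 (fun s => ((s - a) ^+ 2 + c)^-1) (- (2 * (t - a)) * w^-1 ^+ 2).
  have -> : - (2 * (t - a)) * w^-1 ^+ 2 = - w ^- 2 *: (2 * (t - a)).
    by rewrite /GRing.scale/= -exprVn; ring.
  by apply: is_deriveV => //; exact: is_derive_affine_sqr.
elim: n => [|n ih].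
  rewrite mulr0 oppr0 !mul0r.
  have -> : (fun s : R => ((s - a) ^+ 2 + c)^-1 ^+ 0) = cst 1.
    by apply/funext => s; rewrite expr0.
  exact: is_derive_cst.
have -> : - (2 * n.+1%:R) * (t - a) * w^-1 ^+ n.+2 =
  w^-1 *: (- (2 * n%:R) * (t - a) * w^-1 ^+ n.+1) +
  w^-1 ^+ n *: (- (2 * (t - a)) * w^-1 ^+ 2).
  by rewrite /GRing.scale/= !exprS -[n.+1]addn1 natrD; ring.
have -> : (fun s => ((s - a) ^+ 2 + c)^-1 ^+ n.+1) =
  (fun s : R => ((s - a) ^+ 2 + c)^-1) * (fun s => ((s - a) ^+ 2 + c)^-1 ^+ n).
  by apply/funext => s; rewrite fctE exprS.
exact: is_deriveM.
Qed.

Let wgt n a c (s : R) := ((s - a) ^+ 2 + c)^-1 ^+ n.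

(** The function weighted below restricted to a line, and its derivative. *)
Let phi (f : R -> H) n a c e s := wgt n a c s * qdot (f s) (f s) + e * ((s - a) ^+ 2 + c).
Let psi (f g : R -> H) n a c e s :=
  - (2 * n%:R) * (s - a) * wgt n.+1 a c s * qdot (f s) (f s)
  + wgt n a c s * (2 * qdot (f s) (g s)) + e * (2 * (s - a)).

Lemma qdotC p q : qdot p q = qdot q p.
Proof. by rewrite /qdot; ring. Qed.

Let dphi (f g : R -> H) n a c e (s : R) : 0 < (s - a) ^+ 2 + c ->
  is_derive s 1 f (g s) -> is_derive s 1 (phi f n a c e) (psi f g n a c e s).
Proof.
move=> w0 df; rewrite /phi /psi.
apply: is_deriveD; last first.
  have := @is_deriveZ _ _ _ _ e s 1 _ (is_derive_affine_sqr a c s).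
  by [].
have M := is_deriveM (is_derive_inv_pow n w0) (is_derive_qdot df df).
have -> : - (2 * n%:R) * (s - a) * wgt n.+1 a c s * qdot (f s) (f s) +
   wgt n a c s * (2 * qdot (f s) (g s)) =
   wgt n a c s *: (qdot (g s) (f s) + qdot (f s) (g s)) +
   qdot (f s) (f s) *: (- (2 * n%:R) * (s - a) * wgt n.+1 a c s).
  by rewrite (qdotC (g s)) /GRing.scale/=; ring.
exact: M.
Qed.

Let dpsi (f g : R -> H) n a c e (s : R) (A : H) : 0 < (s - a) ^+ 2 + c ->
  is_derive s 1 f (g s) -> is_derive s 1 g A ->
  is_derive s 1 (psi f g n a c e)
   ((- (2 * n%:R) * wgt n.+1 a c s
     + 4 * n%:R * n.+1%:R * (s - a) ^+ 2 * wgt n.+2 a c s) * qdot (f s) (f s)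
    - 8 * n%:R * (s - a) * wgt n.+1 a c s * qdot (f s) (g s)
    + wgt n a c s * (2 * (qdot (g s) (g s) + qdot (f s) A)) + 2 * e).
Proof.
move=> w0 df dg.
have d1 : is_derive s 1 (fun t : R => t - a) 1.
  have := @is_deriveB _ _ _ _ _ s 1 _ _ (is_derive_id s 1) (is_derive_cst a s 1).
  by rewrite subr0.
have M1 := is_deriveM d1 (is_derive_inv_pow n.+1 w0).
have M2 := is_deriveM M1 (is_derive_qdot df df).
have M3 := is_deriveZ (- (2 * n%:R)) M2.
have M4 := is_deriveM (is_derive_inv_pow n w0) (is_deriveZ 2 (is_derive_qdot df dg)).
have M5 := is_deriveZ (2 * e) d1.
have M6 := is_deriveD (is_deriveD M3 M4) M5.
have -> : psi f g n a c e =
  (- (2 * n%:R)) *: ((fun t => t - a) * (fun t => ((t - a) ^+ 2 + c)^-1 ^+ n.+1)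
     * (fun t => qdot (f t) (f t)))
  + (fun t => ((t - a) ^+ 2 + c)^-1 ^+ n) * (2 *: (fun t => qdot (f t) (g t)))
  + (2 * e) *: (fun t => t - a).
  by apply/funext => t; rewrite /psi /wgt !fctE /GRing.scale/=; ring.
set d := (X in is_derive _ _ _ X); set d' := (X in is_derive _ _ _ X) in M6.
have -> // : d = d'.
rewrite /d /d' /wgt /GRing.scale/= !fctE (qdotC (g s) (f s)).
by rewrite -[2 *: qdot _ _]/(2 * qdot (f s) (g s)); ring.
Qed.

(** The square norm of F divided by the 2n-th power of the distance to (a, b), as
    in Hadamard's three circles argument, plus a small multiple of the square of
    that distance that makes it strictly subharmonic. *)
Definition weighted F a b n e x y :=
  ((x - a) ^+ 2 + (y - b) ^+ 2)^-1 ^+ n * qdot (F x y) (F x y)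
  + e * ((x - a) ^+ 2 + (y - b) ^+ 2).

(** With z = (x - a) + (y - b) K and w = |z|^2, the Laplacian of the first summand
    is 4 w^-(n+1) |n F - z h|^2, where h is the complex derivative of F; the second
    summand makes the sum positive, while both second derivatives would be
    nonpositive at a local maximum. Only first derivatives of h occur, which is
    why the principle is stated for the primitive F and not for h. *)
Lemma weighted_no_local_max K F h a b n e x y r A : imag_units K ->
  0 < r -> 0 < e ->
  (forall x' y', box x y r x' y' -> 0 < (x' - a) ^+ 2 + (y' - b) ^+ 2) ->
  (forall x' y', box x y r x' y' ->
    is_derive x' 1 (F^~ y') (h x' y') /\ is_derive y' 1 (F x') (K * h x' y')) ->
  diff2 h x y A (K * A) ->
  ~ (forall x' y', box x y r x' y' -> weighted F a b n e x' y' <= weighted F a b n e x y).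
Proof.
move=> uK r0 e0 wpos dF dh umax.
have bx t : `|t - x| < r -> box x y r t y by move=> ?; rewrite /box subrr normr0.
have by_ t : `|t - y| < r -> box x y r x t by move=> ?; rewrite /box subrr normr0.
have b0 : box x y r x y by apply: bx; rewrite subrr normr0.
have m1 : _ <= 0 := second_derivative_le0 r0
  (fun t ht => dphi (g := h^~ y) n e (wpos _ _ (bx t ht)) (dF _ _ (bx t ht)).1)
  (dpsi n e (wpos _ _ b0) (dF _ _ b0).1 (diff2_derive dh))
  (fun t ht => umax _ _ (bx t ht)).
have wC t : (t - b) ^+ 2 + (x - a) ^+ 2 = (x - a) ^+ 2 + (t - b) ^+ 2 by rewrite addrC.
have wpos' t : `|t - y| < r -> 0 < (t - b) ^+ 2 + (x - a) ^+ 2.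
  by move=> /by_/wpos; rewrite wC.
have umax' t : `|t - y| < r ->
    phi (F x) n b ((x - a) ^+ 2) e t <= phi (F x) n b ((x - a) ^+ 2) e y.
  by move=> /by_/umax; rewrite /weighted /phi /wgt !wC.
have y0 : `|y - y| < r by rewrite subrr normr0.
have m2 : _ <= 0 := second_derivative_le0 r0
  (fun t ht => dphi (g := fun t => K * h x t) n e (wpos' t ht) (dF _ _ (by_ t ht)).2)
  (dpsi n e (wpos' y y0) (dF _ _ b0).2 (diff2_derive (diff2_swap (diff2_mull K dh))))
  umax'.
move: m1 m2; rewrite /wgt wC imag_unitM// => m1 m2.
have w0 := wpos _ _ b0; move: m1 m2 w0.
set X := x - a; set Y := y - b; set w := X ^+ 2 + Y ^+ 2 => m1 m2 w0.
set f := F x y in m1 m2; set g := h x y in m1 m2.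
set v := w^-1 ^+ n.+1.
have v0 : 0 < v by rewrite exprn_gt0// invr_gt0.
have vn : w^-1 ^+ n = v * w by rewrite /v exprSr mulfVK// gt_eqF.
have vn2 : w * w^-1 ^+ n.+2 = v by rewrite exprS mulrA mulfV ?mul1r// gt_eqF.
pose p := X *: g + Y *: (K * g).
have gKg : qdot g (K * g) = 0 by have := qdotMr g g uK; rewrite (qdotC (K * g)); lra.
have KgKg : qdot (K * g) (K * g) = qdot g g.
  by rewrite !qdotqq qnormM imag_unit_norm// mul1r.
have pp : qdot p p = w * qdot g g.
  have -> : qdot p p = X ^+ 2 * qdot g g + 2 * X * Y * qdot g (K * g)
                       + Y ^+ 2 * qdot (K * g) (K * g).
    by rewrite /p /qdot /=; ring.
  by rewrite gKg KgKg /w; ring.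
have fp : qdot f p = X * qdot f g + Y * qdot f (K * g) by rewrite /p /qdot /=; ring.
have fA : qdot f (- A) = - qdot f A by rewrite /qdot /=; ring.
have sq : 0 <= qdot (n%:R *: f - p) (n%:R *: f - p) by rewrite qdotqq sqr_ge0.
have E : qdot (n%:R *: f - p) (n%:R *: f - p) =
    n%:R ^+ 2 * qdot f f - 2 * n%:R * qdot f p + qdot p p.
  by rewrite /qdot /=; ring.
have := mulr_ge0 (ltW v0) sq; rewrite E fp pp.
have n1 : n.+1%:R = n%:R + 1 :> R by rewrite -natr1.
have W2 : X ^+ 2 * w^-1 ^+ n.+2 = v - Y ^+ 2 * w^-1 ^+ n.+2 by rewrite -vn2 /w; ring.
move: m1 m2; rewrite vn fA KgKg n1 -/v.
rewrite -!(mulrA _ (X ^+ 2)) W2; nra.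
Qed.

End Carleman.

(** * Unique continuation on a square *)

Section Spread.
Variable R : realType.
Local Notation H := (quat R).
Implicit Types (p q I J K A B : H) (x y a b c e r s rho C : R) (F G h : R -> R -> H).

Lemma increment_near_le (F f : R -> R) c r C x : `|x - c| < r ->
  (forall t, `|t - c| < r -> is_derive t 1 F (f t)) ->
  (forall t, `|t - c| < r -> `|f t| <= C) -> `|F x - F c| <= C * `|x - c|.
Proof.
move=> xr dF fC; have [cx|/ltW xc] := leP c x.
- have nr t : c <= t <= x -> `|t - c| < r.
    move=> /andP[h1 h2]; apply: le_lt_trans xr.
    by rewrite !ger0_norm ?subr_ge0// lerD2r.
  rewrite (ger0_norm (_ : 0 <= x - c)) ?subr_ge0//.
  by apply: (@increment_le _ F f) => // t /nr; [exact: dF|exact: fC].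
- have nr t : x <= t <= c -> `|t - c| < r.
    move=> /andP[h1 h2]; apply: le_lt_trans xr.
    by rewrite !ler0_norm ?subr_le0// lerN2 lerD2r.
  rewrite distrC (distrC x) (ger0_norm (_ : 0 <= c - x)) ?subr_ge0//.
  by apply: (@increment_le _ F f) => // t /nr; [exact: dF|exact: fC].
Qed.

Lemma diff2_bounded (V : normedModType R) (h : R -> R -> V) x y (A B : V) :
  diff2 h x y A B -> exists r C, 0 < r /\
  forall x' y', box x y r x' y' -> `|h x' y'| <= C.
Proof.
move=> D; have [del del0 Hd] := D 1 ltr01.
exists (Num.min 1 del), (`|h x y| + (2 + `|B| + `|A|)); split.
  by rewrite lt_min ltr01.
move=> x' y'; rewrite /box !lt_min => -[/andP[x1 xd] /andP[y1 yd]].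
have := Hd _ _ xd yd; rewrite mul1r => hb.
have -> : h x' y' = h x y + ((h x' y' - h x y - (x' - x) *: A - (y' - y) *: B)
   + (y' - y) *: B + (x' - x) *: A) by rewrite !subrK addrC subrK.
apply: le_trans (ler_normD _ _) _; rewrite lerD2l.
apply: le_trans (ler_normD _ _) _; apply: lerD; last first.
  by rewrite normrZ ler_piMl// ltW.
apply: le_trans (ler_normD _ _) _; apply: lerD; last first.
  by rewrite normrZ ler_piMl// ltW.
by apply: le_trans hb _; lra.
Qed.

(** F is a primitive of h for the complex variable x + y K. *)
Definition derivs K F h (D : R -> R -> Prop) := forall x y, D x y ->
  is_derive x 1 (F^~ y) (h x y) /\ is_derive y 1 (F x) (K * h x y).

Lemma derivs_lipschitz K F h x y r C pr : imag_units K -> is_coord pr ->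
  derivs K F h (box x y r) -> (forall x' y', box x y r x' y' -> `|h x' y'| <= C) ->
  forall x' y', box x y r x' y' ->
    `|pr (F x' y') - pr (F x y)| <= C * (`|x' - x| + `|y' - y|).
Proof.
move=> uK c dF hC x' y' [hx hy]; have [hD hZ hl] := c.
have r0 : 0 < r by exact: le_lt_trans hx.
have C1 : `|pr (F x' y') - pr (F x' y)| <= C * `|y' - y|.
  apply: (@increment_near_le (fun t => pr (F x' t)) (fun t => pr (K * h x' t)) y r) => // t ht.
    by have [_ d] := dF x' t (conj hx ht); exact: is_derive_coord d.
  apply: le_trans (hl _) _; rewrite qnormM imag_unit_norm// mul1r.
  by apply: hC; split.
have C2 : `|pr (F x' y) - pr (F x y)| <= C * `|x' - x|.
  apply: (@increment_near_le (fun t => pr (F t y)) (fun t => pr (h t y)) x r) => // t ht.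
    have bt : box x y r t y by split; rewrite ?subrr ?normr0.
    by have [d _] := dF t y bt; exact: is_derive_coord d.
  by apply: le_trans (hl _) _; apply: hC; split; rewrite ?subrr ?normr0.
by have := ler_distD (pr (F x' y)) (pr (F x' y')) (pr (F x y)); lra.
Qed.

Lemma box_sub x y r a b rho x' y' : r <= rho - `|x - a| -> r <= rho - `|y - b| ->
  box x y r x' y' -> box a b rho x' y'.
Proof.
move=> ra rb [hx hy]; split.
  by have := ler_distD x x' a; lra.
by have := ler_distD y y' b; lra.
Qed.

Lemma nbhs_box (P : R * R -> Prop) (z : R * R) r : 0 < r ->
  (forall x y, box z.1 z.2 r x y -> P (x, y)) -> \forall z' \near z, P z'.
Proof.
move=> r0 HP; exists (ball z.1 r, ball z.2 r) => /=.
  by split; apply: nbhsx_ballx.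
move=> [x y] [/= hx hy]; apply: HP; split; rewrite distrC; [exact: hx|exact: hy].
Qed.

Lemma derivs_continuous K F h a b rho pr : imag_units K -> is_coord pr ->
  derivs K F h (box a b rho) -> holo K (box a b rho) h ->
  forall z, box a b rho z.1 z.2 ->
    {for z, continuous (fun z : R * R => pr (F z.1 z.2))}.
Proof.
move=> uK c dF hh [x y] /= xy.
have [A /diff2_bounded[r0 [C0 [r00 hC]]]] := hh _ _ xy.
have [xa yb] := xy.
pose r := Num.min r0 (Num.min (rho - `|x - a|) (rho - `|y - b|)).
have rpos : 0 < r by rewrite !lt_min r00 !subr_gt0 xa.
have rr0 : r <= r0 by rewrite ge_min lexx.
have rx : r <= rho - `|x - a| by rewrite !ge_min lexx orbT.
have ry : r <= rho - `|y - b| by rewrite !ge_min lexx !orbT.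
have L := @derivs_lipschitz K F h x y r C0 pr uK c
  (fun x' y' xy' => dF _ _ (box_sub rx ry xy'))
  (fun x' y' xy' => hC _ _ (conj (lt_le_trans xy'.1 rr0) (lt_le_trans xy'.2 rr0))).
have b0 : box x y r0 x y by split; rewrite subrr normr0.
have C00 : 0 <= C0 by have := hC _ _ b0; have := normr_ge0 (h x y); lra.
apply/cvgrPdist_le => e e0.
pose d := Num.min r (e / 2 / (C0 + 1)).
have d0 : 0 < d by rewrite lt_min rpos !divr_gt0// ltr_wpDl.
apply: (nbhs_box d0) => x' y' [/= hx hy].
have dr : d <= r by rewrite ge_min lexx.
have de : d <= e / 2 / (C0 + 1) by rewrite ge_min lexx orbT.
have hx' := lt_le_trans hx de; have hy' := lt_le_trans hy de.
have Lxy := L x' y' (conj (lt_le_trans hx dr) (lt_le_trans hy dr)); rewrite distrC /=; apply: (le_trans Lxy).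
move: hx' hy'; rewrite !ltr_pdivlMr ?ltr_wpDl// => hx' hy'.
have := normr_ge0 (x' - x); have := normr_ge0 (y' - y); lra.
Qed.

Lemma ge0_geometric_le0 a C (q : R) : 0 <= q < 1 -> (forall n, a <= C * q ^+ n) -> a <= 0.
Proof.
move=> /andP[q0 q1] hq.
have cq : (fun n => C * q ^+ n) @ \oo --> (0 : R).
  by apply: cvg_geometric; rewrite ger0_norm.
by apply: (cvgr_to_ge cq); near=> n; exact: hq.
Unshelve. all: by end_near. Qed.

(** A primitive F of h, normalised at the centre, vanishes near it. By the maximum
    principle for the weighted norm, w standing for the square of the distance to
    the centre, |F|^2 is at most M (w / sg^2)^n on the square of half side sg, for
    every n; so F vanishes wherever w < sg^2, and h with it. *)
Lemma holo_zero_spread K h a b rho s : imag_units K -> 0 < s -> 0 < rho ->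
  holo K (box a b rho) h -> (forall x y, box a b s x y -> h x y = 0) ->
  forall x y, box a b (rho / 2) x y -> h x y = 0.
Proof.
move=> uK s0' rho0 hh hz.
pose s1 := Num.min s (rho / 2).
have s0 : 0 < s1 by rewrite lt_min s0' divr_gt0.
have s1r : s1 <= rho / 2 by rewrite ge_min lexx orbT.
have {}hz x y : box a b s1 x y -> h x y = 0.
  by rewrite /box !lt_min => -[/andP[h1 _] /andP[h2 _]]; exact: hz.
(* rho / sqrt 2 < sg: the half square lies in the disc of radius sg *)
pose sg := 3 / 4 * rho; pose rho' := 7 / 8 * rho.
have rr : 0 < rho' < rho by rewrite /rho'; apply/andP; split; lra.
have [F0 dF0] := holo_potential uK rr hh.
pose F x y := F0 x y - F0 a b.
have dF : derivs K F h (box a b rho').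
  move=> x y /dF0[d1 d2]; split.
    by rewrite -[h x y]subr0 /F; apply: is_deriveB.
  by rewrite -[K * h x y]subr0 /F; apply: is_deriveB.
have sub u : u <= rho' -> forall x y, box a b u x y -> box a b rho' x y.
  by move=> ur x y [h1 h2]; split; apply: lt_le_trans ur.
have hh' : holo K (box a b rho') h.
  by apply: holo_sub hh => x y [h1 h2]; split; case/andP: rr => _; exact: lt_trans.
have s1rho : s1 <= rho' by rewrite /rho'; lra.
have Fz x y : box a b s1 x y -> F x y = 0.
  move=> xy; have hz' x' y' : box a b s1 x' y' -> `|h x' y'| <= 0.
    by move=> /hz ->; rewrite normr0.
  have Z pr : is_coord pr -> pr (F x y) = 0.
    move=> c; have := derivs_lipschitz uK c (fun x' y' xy' => dF x' y' (sub _ s1rho _ _ xy')) hz' xy.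
    rewrite mul0r -coordB// /F subrr subr0 normr_le0 => /eqP; exact.
  by apply: quat_eqP; exact: Z.
pose w x y := (x - a) ^+ 2 + (y - b) ^+ 2.
pose sq := `[a - sg, a + sg] `*` `[b - sg, b + sg] : set (R * R).
have sqP x y : sq (x, y) <-> `|x - a| <= sg /\ `|y - b| <= sg.
  rewrite /sq /= !in_itv/= !ler_norml; split=> -[/andP[h1 h2] /andP[h3 h4]];
  by split; apply/andP; split; lra.
have sq_box x y : sq (x, y) -> box a b rho' x y.
  by move=> /sqP[h1 h2]; split; [apply: (le_lt_trans h1)|apply: (le_lt_trans h2)]; rewrite /sg /rho'; lra.
have csq : compact sq by apply: compact_setX; exact: segment_compact.
have sq0 : sq !=set0 by exists (a, b); apply/sqP; rewrite !subrr normr0 /sg; lra.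
have cF pr : is_coord pr -> forall z, box a b rho' z.1 z.2 ->
    {for z, continuous (fun z : R * R => pr (F z.1 z.2))}.
  by move=> c; exact: (derivs_continuous uK c dF hh').
pose N x y := qdot (F x y) (F x y).
have cN z : box a b rho' z.1 z.2 -> {for z, continuous (fun z : R * R => N z.1 z.2)}.
  move=> bz; rewrite /N /qdot.
  have M pr : is_coord pr -> {for z, continuous (fun z : R * R => pr (F z.1 z.2) * pr (F z.1 z.2))}.
    by move=> c; apply: cvgM; exact: cF.
  by apply: cvgD; [apply: cvgD; [apply: cvgD|]|]; exact: M.
have cw (z : R * R) : {for z, continuous (fun z : R * R => w z.1 z.2)}.
  rewrite /w.
  have sqr c (g : R * R -> R) : {for z, continuous g} ->
      {for z, continuous (fun z => (g z - c) ^+ 2)}.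
    move=> cg; have d : {for z, continuous (fun z => g z - c)}.
      by apply: cvgB => //; exact: cvg_cst.
    by rewrite (_ : (fun z => _) = (fun z => (g z - c) * (g z - c))) //; exact: cvgM.
  by apply: cvgD; apply: sqr; [exact: cvg_fst|exact: cvg_snd].
have cu n e z : box a b rho' z.1 z.2 ->
    {for z, continuous (fun z : R * R => weighted F a b n e z.1 z.2)}.
  case: z => x y /= xy.
  have ew : {for (x, y), continuous (fun z : R * R => e * w z.1 z.2)}.
    by apply: cvgM; [exact: cvg_cst|exact: cw].
  have [xy1|xy1] := pselect (box a b s1 x y).
    pose r := Num.min (s1 - `|x - a|) (s1 - `|y - b|).
    have r0 : 0 < r by case: xy1 => h1 h2; rewrite lt_min !subr_gt0 h1.
    have E : \forall z \near (x, y), e * w z.1 z.2 = weighted F a b n e z.1 z.2.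
      apply: (nbhs_box r0) => x' y' /= hb; rewrite /weighted Fz.
        by rewrite qdotqq normr0 expr0n mulr0 add0r.
      by apply: box_sub hb; rewrite /r ge_min lexx ?orbT.
    have V : e * w x y = weighted F a b n e x y.
      by rewrite /weighted Fz// qdotqq normr0 expr0n mulr0 add0r.
    suff : (fun z : R * R => weighted F a b n e z.1 z.2) @ (x, y)
        --> weighted F a b n e x y by [].
    rewrite -V; apply: cvg_trans ew.
    by apply: near_eq_cvg; move: E; apply: filterS => z ->.
  have w0 : w x y != 0.
    rewrite gt_eqF// lt_neqAle addr_ge0 ?sqr_ge0// andbT eq_sym paddr_eq0 ?sqr_ge0//.
    apply/negP => /andP[]; rewrite !sqrf_eq0 => /eqP xa /eqP yb; apply: xy1.
    by rewrite /box xa yb normr0.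
  have iw : {for (x, y), continuous (fun z : R * R => (w z.1 z.2)^-1)}.
    by apply: cvgV => //; exact: (cw (x, y)).
  have iwn : {for (x, y), continuous (fun z : R * R => (w z.1 z.2)^-1 ^+ n)}.
    elim: n => [|n ih].
      rewrite (_ : (fun z : R * R => _) = cst 1); first exact: cst_continuous.
      by apply/funext => z; rewrite expr0.
    rewrite (_ : (fun z : R * R => _) =
      (fun z : R * R => (w z.1 z.2)^-1 * (w z.1 z.2)^-1 ^+ n)).
      exact: (cvgM iw ih).
    by apply/funext => z; rewrite exprS.
  rewrite /weighted; apply: cvgD => //; apply: cvgM => //; exact: (cN (x, y)).
have within (g : R * R -> R) : (forall z, box a b rho' z.1 z.2 -> {for z, continuous g}) ->
    {within sq, continuous g}.
  move=> cg; apply: continuous_in_subspaceT => -[x y] /set_mem xy; apply: cg.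
  exact: sq_box.
have [zM /set_mem zMsq MP] := compact_EVT_max sq0 csq (within _ cN).
set M := N zM.1 zM.2 in MP.
have M0 : 0 <= M by rewrite /M /N qdotqq sqr_ge0.
have sg0 : 0 < sg by rewrite /sg; lra.
have wle x y : sq (x, y) -> w x y <= 2 * sg ^+ 2.
  move=> /sqP[h1 h2]; rewrite /w -[X in X <= _]addr0.
  rewrite -(real_normK (num_real (x - a))) -(real_normK (num_real (y - b))).
  have := normr_ge0 (x - a); have := normr_ge0 (y - b); nra.
have bound n e x y : 0 < e -> sq (x, y) ->
    weighted F a b n e x y <= M * (sg ^+ 2)^-1 ^+ n + e * (2 * sg ^+ 2).
  move=> e0 xysq.
  have [[x1 y1] /set_mem z1sq /= zP] := compact_EVT_max sq0 csq (within _ (cu n e)).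
  have {}zP x' y' : sq (x', y') -> weighted F a b n e x' y' <= weighted F a b n e x1 y1.
    by move=> h'; apply: (zP (x', y')); exact/mem_set.
  apply: le_trans (zP _ _ xysq) _; rewrite /weighted; apply: lerD; last first.
    by rewrite ler_wpM2l ?(ltW e0)//; exact: wle.
  have sgn : 0 <= (sg ^+ 2)^-1 ^+ n by rewrite exprn_ge0// invr_ge0 sqr_ge0.
  have [F1|F1] := eqVneq (F x1 y1) 0.
    by rewrite F1 qdotqq normr0 expr0n mulr0 mulr_ge0.
  (* a maximum where F does not vanish lies on the boundary of the square *)
  have far : sg ^+ 2 <= w x1 y1.
    rewrite leNgt; apply/negP => wlt.
    have [xa yb] : `|x1 - a| < sg /\ `|y1 - b| < sg.
      have := sqr_ge0 (x1 - a); have := sqr_ge0 (y1 - b); move: wlt; rewrite /w.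
      move=> wlt p1 p2.
      by split; rewrite -(@ltr_pXn2r _ 2) ?nnegrE ?(ltW sg0)// real_normK ?num_real//; lra.
    pose r := Num.min s1 (Num.min (sg - `|x1 - a|) (sg - `|y1 - b|)).
    have r0 : 0 < r by rewrite lt_min s0 lt_min !subr_gt0 xa.
    have rs : r <= s1 by rewrite ge_min lexx.
    have rx : r <= sg - `|x1 - a| by rewrite !ge_min lexx orbT.
    have ry : r <= sg - `|y1 - b| by rewrite !ge_min lexx !orbT.
    have insq x' y' : box x1 y1 r x' y' -> sq (x', y').
      by move=> /(box_sub rx ry)[h1 h2]; apply/sqP; rewrite !ltW.
    have [A dA] := hh' _ _ (sq_box _ _ z1sq).
    apply: (@weighted_no_local_max _ K F h a b n e x1 y1 r A) => //.
    - move=> x' y' hb; rewrite lt_neqAle addr_ge0 ?sqr_ge0// andbT eq_sym.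
      rewrite paddr_eq0 ?sqr_ge0// !sqrf_eq0.
      apply/negP => /andP[/eqP/subr0_eq xa' /eqP/subr0_eq yb'].
      move: F1; rewrite Fz ?eqxx//; case: hb; rewrite xa' yb' => h1 h2.
      by split; rewrite distrC; exact: lt_le_trans rs.
    - by move=> x' y' /insq/sq_box/dF.
    - by move=> x' y' /insq/zP.
  rewrite mulrC; apply: ler_pM => //.
  - by rewrite qdotqq sqr_ge0.
  - by rewrite exprn_ge0// invr_ge0 addr_ge0 ?sqr_ge0.
  - by apply: (MP (x1, y1)); exact/mem_set.
  - apply: lerXn2r; rewrite ?nnegrE ?invr_ge0 ?addr_ge0 ?sqr_ge0//.
    by rewrite lef_pV2 ?posrE ?exprn_gt0// (lt_le_trans _ far) ?exprn_gt0.
have Fhalf x y : box a b (rho / 2) x y -> F x y = 0.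
  move=> [h1 h2]; have [xy1|xy1] := pselect (box a b s1 x y); first exact: Fz.
  have w0 : 0 < w x y.
    rewrite lt_neqAle addr_ge0 ?sqr_ge0// andbT eq_sym paddr_eq0 ?sqr_ge0//.
    apply/negP => /andP[]; rewrite !sqrf_eq0 => /eqP xa /eqP yb; apply: xy1.
    by rewrite /box xa yb normr0.
  have xysq : sq (x, y) by apply/sqP; rewrite /sg; split; lra.
  have wsg : w x y < sg ^+ 2.
    rewrite /w -(real_normK (num_real (x - a))) -(real_normK (num_real (y - b))).
    have := normr_ge0 (x - a); have := normr_ge0 (y - b); rewrite /sg; nra.
  have B n : N x y * (w x y)^-1 ^+ n <= M * (sg ^+ 2)^-1 ^+ n.
    rewrite -subr_le0; apply: (@le0_of_le_eps _ _ (2 * sg ^+ 2)).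
      by rewrite mulr_ge0// sqr_ge0.
    move=> e e0; have := bound n e x y e0 xysq.
    have ew : 0 < e * w x y by rewrite mulr_gt0.
    by move: ew; rewrite /weighted -/(w x y) -/(N x y) mulrC; lra.
  have q01 : 0 <= w x y / sg ^+ 2 < 1.
    by rewrite divr_ge0 ?sqr_ge0 ?(ltW w0)//= ltr_pdivrMr ?exprn_gt0// mul1r.
  have : N x y <= 0.
    apply: (ge0_geometric_le0 (C := M) q01) => n.
    have wn : 0 < w x y ^+ n by rewrite exprn_gt0.
    have := B n; rewrite [(w x y)^-1 ^+ n]exprVn ler_pdivrMr// => h'; apply: le_trans h' _.
    by rewrite -mulrA -exprMn [_^-1 * _]mulrC.
  rewrite /N qdotqq => Nn; apply/eqP; rewrite -normr_eq0 -sqrf_eq0 eq_le Nn.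
  exact: sqr_ge0.
move=> x y xy; have [xa yb] := xy.
have d0 : 0 < rho / 2 - `|x - a| by rewrite subr_gt0.
have bx : box a b rho' x y by apply: sub xy; rewrite /rho'; lra.
apply: (derive_locally_zero d0) (dF x y bx).1 => t tx; rewrite Fhalf//; split => //.
by have := ler_distD x t a; lra.
Qed.

End Spread.

(** * The identity theorem *)

Section Identity.
Variable R : realType.
Local Notation H := (quat R).
Implicit Types (p q I J K A B : H) (x y a b c d e r s t rho C : R) (F G h : R -> R -> H).
Implicit Types (U D N : R -> R -> Prop).

Definition convex2 U := forall x y x' y' t, 0 <= t <= 1 -> U x y -> U x' y' ->
  U (x + t * (x' - x)) (y + t * (y' - y)).

Definition open2 U := forall x y, U x y -> exists2 r, 0 < r &
  forall x' y', box x y r x' y' -> U x' y'.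

(** Along the segment joining the two points, the set of parameters where N holds
    is open and closed. *)
Lemma convex_propagation U N x0 y0 x1 y1 : convex2 U ->
  (forall x y, U x y -> exists2 r, 0 < r & forall a b a' b',
     box x y r a b -> box x y r a' b' -> N a b -> N a' b') ->
  U x0 y0 -> U x1 y1 -> N x0 y0 -> N x1 y1.
Proof.
move=> cU loc U0 U1 N0.
pose gx t := x0 + t * (x1 - x0); pose gy t := y0 + t * (y1 - y0).
pose A := `[0, 1]%classic : set R.
pose B := [set t | A t /\ N (gx t) (gy t)].
pose m := `|x1 - x0| + `|y1 - y0| + 1.
have m0 : 0 < m by rewrite ltr_wpDl// addr_ge0.
have locB t : A t -> exists2 del, 0 < del & forall s, A s -> `|s - t| < del ->
    (N (gx t) (gy t) <-> N (gx s) (gy s)).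
  rewrite /A /= in_itv/= => At; have [r r0 H] := loc _ _ (cU _ _ _ _ _ At U0 U1).
  exists (r / m) => [|s As]; first by rewrite divr_gt0.
  rewrite ltr_pdivlMr// => sm.
  have bt : box (gx t) (gy t) r (gx t) (gy t) by rewrite /box !subrr normr0.
  have bs : box (gx t) (gy t) r (gx s) (gy s).
    rewrite /box (_ : gx s - gx t = (s - t) * (x1 - x0)); last by rewrite /gx; ring.
    rewrite (_ : gy s - gy t = (s - t) * (y1 - y0)); last by rewrite /gy; ring.
    rewrite !normrM; have := mulr_ge0 (normr_ge0 (s - t)) (normr_ge0 (x1 - x0)).
    have := mulr_ge0 (normr_ge0 (s - t)) (normr_ge0 (y1 - y0)).
    by have := normr_ge0 (s - t); move: sm; rewrite /m; split; lra.
  by split; exact: H.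
have A0 : A 0 by rewrite /A /= in_itv/= lexx ler01.
have A1 : A 1 by rewrite /A /= in_itv/= lexx ler01.
have BA : B = A.
  apply: (@segment_connected R 0 1).
  - by exists 0; split => //; rewrite /gx /gy !mul0r !addr0.
  - exists (interior [set t | A t -> B t]); first exact: open_interior.
    apply/seteqP; split => [t [At Nt]|t [At /interior_subset]]; last exact.
    split => //; have [del del0 H] := locB t At.
    exists del => //= s st As; split => //.
    have st' : `|s - t| < del by rewrite distrC; exact: st.
    exact: (H s As st').1 Nt.
  - exists (closure B); first exact: closed_closure.
    apply/seteqP; split => [t Bt|t [At clB]].
      by split; [exact: Bt.1|exact: subset_closure].
    have [del del0 H] := locB t At; split => //.
    have [s [[As Ns] st]] := clB _ (nbhsx_ballx t del del0).
    have st' : `|s - t| < del by rewrite distrC; exact: st.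
    exact: (H s As st').2 Ns.
have : B 1 by rewrite BA.
by case=> _; rewrite /gx /gy !mul1r [x0 + _]addrC [y0 + _]addrC !subrK.
Qed.

Lemma box_convex a b r : convex2 (box a b r).
Proof.
have H u v t : 0 <= t <= 1 -> `|u| < r -> `|v| < r -> `|u + t * (v - u)| < r.
  move=> /andP[t0 t1]; rewrite !ltr_norml => /andP[u1 u2] /andP[v1 v2].
  have t1' : 0 <= 1 - t by lra.
  have [uv|/ltW vu] := leP u v.
    have uv' : 0 <= v - u by lra.
    have w1 := mulr_ge0 t0 uv'; have w2 := mulr_ge0 t1' uv'.
    by apply/andP; split; lra.
  have vu' : 0 <= u - v by lra.
  have w1 := mulr_ge0 t0 vu'; have w2 := mulr_ge0 t1' vu'.
  by apply/andP; split; lra.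
move=> x y x' y' t t01 [h1 h2] [h3 h4]; split.
  have -> : x + t * (x' - x) - a = x - a + t * (x' - a - (x - a)) by ring.
  exact: H.
have -> : y + t * (y' - y) - b = y - b + t * (y' - b - (y - b)) by ring.
exact: H.
Qed.

Lemma box_open a b r : open2 (box a b r).
Proof.
move=> x y [xa yb]; exists (Num.min (r - `|x - a|) (r - `|y - b|)).
  by rewrite lt_min !subr_gt0 xa.
by move=> x' y'; apply: box_sub; rewrite ge_min lexx ?orbT.
Qed.

Lemma boxW a b r r' x y : r <= r' -> box a b r x y -> box a b r' x y.
Proof. by move=> rr [h1 h2]; split; apply: lt_le_trans rr. Qed.

(** Vanishing near a point propagates from square to square by the local result. *)
Lemma identity_convex K h U a b s : imag_units K -> convex2 U -> open2 U ->
  holo K U h -> U a b -> 0 < s -> (forall x y, box a b s x y -> h x y = 0) ->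
  forall x y, U x y -> h x y = 0.
Proof.
move=> uK cU oU hh Uab s0 hz x1 y1 U1.
pose N x y := exists2 s, 0 < s & forall x' y', box x y s x' y' -> h x' y' = 0.
suff [s' s'0] : N x1 y1 by apply; rewrite /box !subrr normr0.
apply: (convex_propagation cU _ Uab U1); last by exists s.
move=> x y /oU[r r0 rU]; exists (r / 8) => [|c d c' d' [p1 p2] [q1 q2] [s' s'0 zs]].
  by rewrite divr_gt0.
have hd : holo K (box c d (3 / 4 * r)) h.
  by apply: holo_sub hh => u v bu; apply: rU; apply: box_sub bu; lra.
have r340 : 0 < 3 / 4 * r by lra.
have z := holo_zero_spread uK s'0 r340 hd zs.
exists (r / 8) => [|u v bu]; first by rewrite divr_gt0.
apply: z; apply: box_sub bu.
  by have := ler_distD x c' c; rewrite (distrC x); lra.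
by have := ler_distD y d' d; rewrite (distrC y); lra.
Qed.

(** Going around a puncture needs no winding: the four half squares cut by the
    axes through it are convex, and consecutive ones overlap. *)
Lemma identity_punctured K h a b r x0 y0 s : imag_units K -> 0 < r ->
  holo K (fun x y => box a b r x y /\ (x, y) <> (a, b)) h ->
  box a b r x0 y0 -> (x0, y0) <> (a, b) -> 0 < s ->
  (forall x y, box x0 y0 s x y -> h x y = 0) ->
  forall x y, box a b r x y -> (x, y) <> (a, b) -> h x y = 0.
Proof.
move=> uK r0 hh b0 n0 s0 hz.
pose half c d x y := box a b r x y /\ 0 < c * (x - a) + d * (y - b).
have half_conv c d : convex2 (half c d).
  move=> x y x' y' t t01 [bx lx] [bx' lx']; split; first exact: box_convex.
  have -> : c * (x + t * (x' - x) - a) + d * (y + t * (y' - y) - b) =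
    (1 - t) * (c * (x - a) + d * (y - b)) + t * (c * (x' - a) + d * (y' - b)) by ring.
  by move: lx lx'; set u := c * _ + _; set v := c * _ + _; case/andP: t01; nra.
have half_open c d : open2 (half c d).
  move=> x y [/box_open[r1 r10 h1] lx].
  pose l := c * (x - a) + d * (y - b); pose m := `|c| + `|d| + 1.
  have m0 : 0 < m by rewrite ltr_wpDl// addr_ge0.
  exists (Num.min r1 (l / m)); first by rewrite lt_min r10 divr_gt0.
  move=> x' y'; rewrite /box !lt_min => -[/andP[x1 x2] /andP[y1 y2]].
  split; first by apply: h1.
  move: x2 y2; rewrite !ltr_pdivlMr// => x2 y2.
  have -> : c * (x' - a) + d * (y' - b) = l + (c * (x' - x) + d * (y' - y)).
    by rewrite /l; ring.
  have : `|c * (x' - x) + d * (y' - y)| < l.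
    have l0 : 0 < l by [].
    apply: le_lt_trans (ler_normD _ _) _; rewrite !normrM.
    have [xy|xy] := leP `|x' - x| `|y' - y|.
      have := normr_ge0 (y' - y); have := normr_ge0 c; have := normr_ge0 d.
      by have := normr_ge0 (x' - x); move: x2 y2; rewrite /m; nra.
    have := normr_ge0 (y' - y); have := normr_ge0 c; have := normr_ge0 d.
    by have := normr_ge0 (x' - x); move: x2 y2; rewrite /m; nra.
  by rewrite ltr_norml => /andP[]; lra.
have half_holo c d : holo K (half c d) h.
  apply: holo_sub hh => x y [bx lx]; split => // -[xa yb].
  by move: lx; rewrite xa yb !subrr !mulr0 addr0 ltxx.
have turn c d : `|c| <= 1 -> `|d| <= 1 -> 0 < c ^+ 2 + d ^+ 2 ->
    (forall x y, half c d x y -> h x y = 0) ->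
    forall x y, half (- d) c x y -> h x y = 0.
  rewrite !ler_norml => /andP[c1 c2] /andP[d1 d2] cd z.
  (* on the bisector of the two directions, hence in both half squares *)
  pose x1 := a + (c - d) * r / 4; pose y1 := b + (d + c) * r / 4.
  have bx1 : box a b r x1 y1.
    rewrite /box /x1 /y1 (addrC a) (addrC b) !addrK !ltr_norml.
    by split; apply/andP; split; nra.
  have cdr : 0 < (c ^+ 2 + d ^+ 2) * r / 4 by rewrite divr_gt0// mulr_gt0.
  have h1 : half c d x1 y1.
    split => //; have -> // : c * (x1 - a) + d * (y1 - b) = (c ^+ 2 + d ^+ 2) * r / 4.
    by rewrite /x1 /y1; ring.
  have h2 : half (- d) c x1 y1.
    split => //; have -> // : - d * (x1 - a) + c * (y1 - b) = (c ^+ 2 + d ^+ 2) * r / 4.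
    by rewrite /x1 /y1; ring.
  have [s1 s10 sub] := half_open _ _ _ _ h1.
  apply: (identity_convex uK (half_conv (- d) c) (half_open (- d) c)
    (half_holo (- d) c) h2 s10).
  by move=> x y /sub; exact: z.
have all4 c d : `|c| <= 1 -> `|d| <= 1 -> 0 < c ^+ 2 + d ^+ 2 ->
    (c, d) = (1, 0) \/ (c, d) = (0, 1) \/ (c, d) = (-1, 0) \/ (c, d) = (0, -1) ->
    half c d x0 y0 ->
    forall x y, box a b r x y -> (x, y) <> (a, b) -> h x y = 0.
  move=> c1 d1 cd cdE h0.
  have z0 : forall x y, half c d x y -> h x y = 0.
    exact: (identity_convex uK (half_conv c d) (half_open c d) (half_holo c d) h0 s0).
  have z1 := turn _ _ c1 d1 cd z0.
  have z2 : forall x y, half (- c) (- d) x y -> h x y = 0.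
    by apply: turn => //; rewrite ?normrN// sqrrN addrC.
  have z3 : forall x y, half (- - d) (- c) x y -> h x y = 0.
    by apply: turn => //; rewrite ?normrN// !sqrrN.
  move=> x y bx nxy.
  have : x != a \/ y != b.
    have [xa|] := eqVneq x a; last by left.
    by right; apply/eqP => yb; apply: nxy; rewrite xa yb.
  have pz (u v : R) : u != 0 -> 0 < u \/ 0 < - u.
    by move=> u0; case: (ltgtP u 0) u0 => // ?; [right; lra|left].
  move=> nab.
  have Q : 0 < x - a \/ 0 < - (x - a) \/ 0 < y - b \/ 0 < - (y - b).
    by case: nab; rewrite -subr_eq0 => /pz[]; tauto.
  rewrite opprK in z3.
  case: cdE => [|[|[|]]] [cE dE]; rewrite cE dE in z0 z1 z2 z3;
  by case: Q => [|[|[|]]] p;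
  first [apply: z0; split => //; lra | apply: z1; split => //; lra |
         apply: z2; split => //; lra | apply: z3; split => //; lra].
have n1' : `|1 : R| <= 1 by rewrite normr1.
have n0' : `|0 : R| <= 1 by rewrite normr0.
have nN1 : `|-1 : R| <= 1 by rewrite normrN normr1.
have [xa|xa] := ltP 0 (x0 - a).
  by apply: (all4 1 0 n1' n0'); [lra|left|split => //; lra].
have [xa'|xa'] := ltP (x0 - a) 0.
  by apply: (all4 (-1) 0 nN1 n0'); [lra|right; right; left|split => //; lra].
have x0a : x0 = a by lra.
have y0b : y0 <> b by move=> y0b; apply: n0; rewrite x0a y0b.
have [yb|yb] := ltP 0 (y0 - b).
  by apply: (all4 0 1 n0' n1'); [lra|right; left|split => //; lra].
apply: (all4 0 (-1) n0' nN1); [lra|by right; right; right|split => //].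
by move/eqP: y0b; rewrite neq_lt => /orP[]; lra.
Qed.

Lemma diff2_limit0 (V : normedModType R) (h : R -> R -> V) x y (A B : V) r : 0 < r ->
  diff2 h x y A B -> (forall x', x' != x -> `|x' - x| < r -> h x' y = 0) -> h x y = 0.
Proof.
move=> r0 D hz; have [del del0 Hd] := D 1 ltr01.
have A0 := normr_ge0 A.
apply/eqP; rewrite -normr_le0; apply: (@le0_of_le_eps _ _ (1 + `|A|)); first lra.
move=> e e0; pose u := Num.min (Num.min del r) e / 2.
have m1 : Num.min (Num.min del r) e <= e by rewrite ge_min lexx orbT.
have m2 : Num.min (Num.min del r) e <= r by rewrite !ge_min lexx !orbT.
have m3 : Num.min (Num.min del r) e <= del by rewrite !ge_min lexx.
have u0 : 0 < u by rewrite divr_gt0// !lt_min del0 r0.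
have E : x + u - x = u by ring.
have nu : `|x + u - x| = u by rewrite E gtr0_norm.
have := Hd (x + u) y; rewrite nu subrr normr0 scale0r subr0 addr0 mul1r.
have ud : u < del by rewrite /u; lra.
rewrite hz ?nu//; [|by rewrite -subr_eq0 E gt_eqF|by rewrite /u; lra].
rewrite E => /(_ ud del0) h1.
have -> : h x y = - ((0 - h x y - u *: A) + u *: A) by rewrite subrK sub0r opprK.
rewrite normrN; apply: le_trans (ler_normD _ _) _; rewrite normrZ (gtr0_norm u0).
have ue : u < e by rewrite /u; lra.
nra.
Qed.

(** The hypothesis on D is what a closed discrete set of singularities provides:
    punctured squares around every point of U. Vanishing propagates inside each
    of them, and then along the segments of U. *)
Lemma identity_off_discrete K h U D x0 y0 s : imag_units K -> convex2 U ->
  holo K D h ->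
  (forall x y, U x y -> exists2 r, 0 < r & forall x' y', box x y r x' y' ->
     (x', y') <> (x, y) -> D x' y') ->
  U x0 y0 -> 0 < s -> (forall x y, box x0 y0 s x y -> D x y -> h x y = 0) ->
  forall x y, U x y -> D x y -> h x y = 0.
Proof.
move=> uK cU hh disc U0 s0 hz x1 y1 U1 D1.
pose N x y := exists2 s, 0 < s & forall x' y', box x y s x' y' -> D x' y' -> h x' y' = 0.
suff [s' s'0] : N x1 y1 by apply => //; rewrite /box !subrr normr0.
apply: (convex_propagation cU _ U0 U1); last by exists s.
move=> a b /disc[r r0 rD]; exists r => // c d c' d' bc bc' [s' s'0 zs].
have [ca db] := bc; have [ca' db'] := bc'.
pose t := Num.min (s' / 2) (Num.min ((r - `|c - a|) / 2) (r - `|d - b|)).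
have t0 : 0 < t.
  have [sa sb] : 0 < r - `|c - a| /\ 0 < r - `|d - b| by rewrite !subr_gt0.
  by rewrite /t !lt_min sb !divr_gt0.
have t1 : t <= s' / 2 by rewrite ge_min lexx.
have t2 : t <= (r - `|c - a|) / 2 by rewrite !ge_min lexx orbT.
have t3 : t <= r - `|d - b| by rewrite !ge_min lexx !orbT.
(* a small square on the side of (c, d) that points away from the puncture *)
have [c1 [c1a c1n]] : exists c1, `|c1 - c| = t /\
    forall x y, box c1 d t x y -> x <> a.
  have [ac|ac] := leP a c.
    exists (c + t); split; first by rewrite addrAC subrr add0r gtr0_norm.
    move=> x y [+ _]; rewrite ltr_norml => /andP[]; lra.
  exists (c - t); split; first by rewrite addrAC subrr add0r normrN gtr0_norm.
  move=> x y [+ _]; rewrite ltr_norml => /andP[]; lra.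
have dd : `|d - d| = 0 by rewrite subrr normr0.
have sub_s x y : box c1 d t x y -> box c d s' x y.
  by apply: box_sub; rewrite ?c1a ?dd; lra.
have sub_r x y : box c1 d t x y -> box a b r x y.
  apply: box_sub; last by lra.
  by have := ler_distD c c1 a; rewrite c1a; lra.
have bt : box c1 d t c1 d by rewrite /box !subrr normr0.
have hh' : holo K (fun x y => box a b r x y /\ (x, y) <> (a, b)) h.
  by apply: holo_sub hh => x y [bx nx]; exact: rD.
have zt x y : box c1 d t x y -> h x y = 0.
  move=> bx; apply: zs; first exact: sub_s.
  by apply: rD; [exact: sub_r|case=> /(c1n _ _ bx)].
have nc1 : (c1, d) <> (a, b) by case=> /(c1n _ _ bt).
have zp := identity_punctured uK r0 hh' (sub_r _ _ bt) nc1 t0 zt.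
have [s2 s20 sub2] := box_open bc'.
exists s2 => // x y /sub2 bxy Dxy.
have [xy|xy] := pselect ((x, y) = (a, b)); last exact: zp.
case: xy => xa yb; rewrite xa yb in Dxy *.
have [A dA] := hh _ _ Dxy.
apply: (diff2_limit0 r0 dA) => x' /eqP nx xr; apply: zp; last by case.
by split; rewrite ?subrr ?normr0.
Qed.

End Identity.

(** * Slices and the coefficients of the representation formula *)

Section SlicePoints.
Variable R : realType.
Local Notation H := (quat R).
Implicit Types (p q I J K A B : H) (x y a b c d e s t rho C : R) (F G h : R -> R -> H).

Definition slice_pt I x y : H := x%:A + y *: I.

Lemma ptB I x y x' y' : slice_pt I x y - slice_pt I x' y' = slice_pt I (x - x') (y - y').
Proof. by rewrite /slice_pt !scalerBl; apply: quat_eqP => /=; ring. Qed.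

Lemma pt_norm I x y : imag_units I -> `|slice_pt I x y| ^+ 2 = x ^+ 2 + y ^+ 2.
Proof.
move=> /imag_unitP[r0 n1]; rewrite qnorm_sqr /qsqnorm /slice_pt /= r0.
have -> : x ^+ 2 + y ^+ 2 = x ^+ 2 + y ^+ 2 * (qi I ^+ 2 + qj I ^+ 2 + qk I ^+ 2).
  by rewrite n1 mulr1.
by ring.
Qed.

Lemma pt_normE I J x y : imag_units I -> imag_units J -> `|slice_pt I x y| = `|slice_pt J x y|.
Proof.
by move=> uI uJ; apply/eqP; rewrite -(@eqrXn2 _ 2)// !pt_norm.
Qed.

Lemma qr_pt I x y : imag_units I -> qr (slice_pt I x y) = x.
Proof. by move=> /imag_unitP[r0 _]; rewrite /slice_pt /= r0; ring. Qed.

Lemma pt_inj I x y x' y' : imag_units I -> slice_pt I x y = slice_pt I x' y' -> (x, y) = (x', y').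
Proof.
move=> uI E; have : `|slice_pt I x y - slice_pt I x' y'| ^+ 2 = 0 by rewrite E subrr normr0 expr0n.
rewrite ptB pt_norm// => /eqP; rewrite paddr_eq0 ?sqr_ge0// !sqrf_eq0 !subr_eq0.
by move=> /andP[/eqP -> /eqP ->].
Qed.

Lemma imag_unitN I : imag_units I -> imag_units (- I).
Proof. by rewrite /imag_units/= sqrrN. Qed.

Lemma ptN I x y : slice_pt (- I) x y = slice_pt I x (- y).
Proof. by rewrite /slice_pt scalerN scaleNr. Qed.

Lemma pt0 I x : slice_pt I x 0 = x%:A.
Proof. by rewrite /slice_pt scale0r addr0. Qed.

Lemma qnorm1 : `|1 : H| = 1.
Proof.
by apply/eqP; rewrite -sqrp_eq1// qnorm_sqr /qsqnorm /= expr1n !expr0n /= !addr0.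
Qed.

Lemma pt_norm_le I x y : imag_units I -> `|slice_pt I x y| <= `|x| + `|y|.
Proof.
move=> uI; apply: le_trans (ler_normD _ _) _.
by rewrite !normrZ qnorm1 imag_unit_norm// !mulr1.
Qed.

Lemma nbhs_pt I x y (V : set H) : imag_units I -> nbhs (slice_pt I x y) V ->
  exists2 r, 0 < r & forall x' y', box x y r x' y' -> V (slice_pt I x' y').
Proof.
move=> uI /nbhs_ballP[e /= e0 eV]; exists (e / 2); first by rewrite divr_gt0.
move=> x' y' [hx hy]; apply: eV; rewrite -ball_normE /=.
rewrite distrC ptB; apply: le_lt_trans (pt_norm_le _ _ uI) _; lra.
Qed.

Lemma differentiable_diff2 (f : H -> H) I x y : imag_units I ->
  differentiable f (slice_pt I x y) -> exists A B, diff2 (fun s t => f (slice_pt I s t)) x y A B.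
Proof.
move=> uI df; have /eqaddoP Hf := diff_locally df.
exists ('d f (slice_pt I x y) 1), ('d f (slice_pt I x y) I) => e e0.
have e20 : 0 < e by [].
have /nbhs_ballP[del /= del0 Hd] := Hf _ e20.
exists (del / 2) => [|x' y' hx hy]; first by rewrite divr_gt0.
pose v := slice_pt I (x' - x) (y' - y).
have nl : `|v| <= `|x' - x| + `|y' - y| by exact: pt_norm_le.
have vdel : ball (0 : H) del v by rewrite -ball_normE /= sub0r normrN; lra.
have {Hd} := Hd v vdel; rewrite /= !fctE /=.
have -> : v + slice_pt I x y = slice_pt I x' y' by rewrite /v -ptB subrK.
have -> : 'd f (slice_pt I x y) v = (x' - x) *: 'd f (slice_pt I x y) 1 + (y' - y) *: 'd f (slice_pt I x y) I.
  by rewrite /v /slice_pt linearD !linearZ.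
rewrite !opprD !addrA => Hp.
by apply: le_trans Hp _; rewrite ler_wpM2l ?(ltW e0).
Qed.

Lemma derive1_is_derive (f : R -> H) (t : R) (d : H) : is_derive t 1 f d -> derive1 f t = d.
Proof. by move=> df; rewrite derive1E derive_val. Qed.

Lemma dbar_diff2 (f : H -> H) I x y A B : diff2 (fun s t => f (slice_pt I s t)) x y A B ->
  dbar I f x y = 2^-1 *: (A + I * B).
Proof.
move=> D; rewrite /dbar.
by rewrite (derive1_is_derive (diff2_derive D)) (derive1_is_derive (diff2_derive (diff2_swap D))).
Qed.

Lemma regular_diff2 (D : set H) (f : H -> H) I x y : imag_units I ->
  regular D f -> D (slice_pt I x y) ->
  exists A, diff2 (fun s t => f (slice_pt I s t)) x y A (I * A).
Proof.
move=> uI [_ df cr] Dp; have [A [B dAB]] := differentiable_diff2 uI (df _ Dp).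
have := cr I uI x y Dp; rewrite (dbar_diff2 dAB) => /eqP.
rewrite scaler_eq0 invr_eq0 pnatr_eq0 /= => /eqP E.
exists A; have -> // : I * A = B.
have -> : A = - (I * B) by apply/eqP; rewrite -addr_eq0 E.
by rewrite mulrN imag_unitM// opprK.
Qed.

(** The coefficients of the representation formula: on the left they turn the
    complex structures of the slices through I and J into that of the slice
    through K. *)
Definition rep_coefl K I J := (K - J) / (I - J).
Definition rep_coefr K I J := (I - K) / (I - J).

Lemma subr_unit I J : I != J -> I - J \is a GRing.unit.
Proof. by move=> IJ; rewrite unfold_in /= subr_eq0. Qed.

Lemma rep_sum K I J : I != J -> rep_coefl K I J + rep_coefr K I J = 1.
Proof.
move=> /subr_unit uIJ; rewrite /rep_coefl /rep_coefr -mulrDl addrC.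
by rewrite (_ : I - K + (K - J) = I - J) ?divrr// addrA subrK.
Qed.

Lemma diff_intertwine I J : imag_units I -> imag_units J -> I != J ->
  (I - J)^-1 * I = - J * (I - J)^-1.
Proof.
move=> uI uJ IJ; have uIJ := subr_unit IJ.
apply: (mulrI uIJ); rewrite mulrA divrr// mul1r mulrA.
have -> : (I - J) * - J = I * (I - J).
  rewrite mulrBl !mulrN opprK mulrBr imag_unit_sqr// imag_unit_sqr//.
  by rewrite addrC.
by rewrite mulrK.
Qed.

Lemma rep_coefl_intertwine K I J : imag_units K -> imag_units I -> imag_units J -> I != J ->
  rep_coefl K I J * I = K * rep_coefl K I J.
Proof.
move=> uK uI uJ IJ; rewrite /rep_coefl -mulrA diff_intertwine// !mulrA; congr (_ * _).
by rewrite mulrN mulrBl mulrBr !imag_unit_sqr// opprB.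
Qed.

Lemma rep_coefr_swap K I J : rep_coefr K I J = rep_coefl K J I.
Proof. by rewrite /rep_coefr /rep_coefl -[I - K]opprB -[I - J]opprB invrN mulrNN. Qed.

Lemma rep_coefr_intertwine K I J : imag_units K -> imag_units I -> imag_units J -> I != J ->
  rep_coefr K I J * J = K * rep_coefr K I J.
Proof. by move=> *; rewrite rep_coefr_swap rep_coefl_intertwine// eq_sym. Qed.

End SlicePoints.

(** * The representation formula *)

Section Representation.
Variable R : realType.
Local Notation H := (quat R).
Implicit Types (p q I J K A B : H) (x y a b c d e s t rho C : R) (F G h : R -> R -> H).
Implicit Types (r : \bar R) (S D : set H) (f : H -> H).

Lemma qball_open r : open (qball r : set H).
Proof.
rewrite openE => q; rewrite /qball /=; case: r => [r|_|//]; last first.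
  by apply: filterE => p /=; rewrite ltry.
rewrite lte_fin => qr; apply/nbhs_ballP; exists (r - `|q|) => /=.
  by rewrite subr_gt0.
move=> p; rewrite -ball_normE /= => qp; rewrite lte_fin.
by have := ler_normD (p - q) q; rewrite subrK distrC; lra.
Qed.

Lemma qball_norm_le r p q : `|p| <= `|q| -> qball r q -> qball r p.
Proof. by move=> pq; apply: le_lt_trans; rewrite lee_fin. Qed.

Lemma qball_convex r I : convex2 (fun x y => qball r (slice_pt I x y)).
Proof.
move=> x y x' y' t /andP[t0 t1] h1 h2.
have -> : slice_pt I (x + t * (x' - x)) (y + t * (y' - y)) =
    (1 - t) *: slice_pt I x y + t *: slice_pt I x' y'.
  by rewrite /slice_pt; apply: quat_eqP => /=; ring.
have t1' : 0 <= 1 - t by lra.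
have H1 : `|(1 - t) *: slice_pt I x y + t *: slice_pt I x' y'| <=
    (1 - t) * `|slice_pt I x y| + t * `|slice_pt I x' y'|.
  by apply: le_trans (ler_normD _ _) _; rewrite !normrZ (ger0_norm t0) (ger0_norm t1').
have [le|/ltW le] := leP `|slice_pt I x y| `|slice_pt I x' y'|.
  apply: qball_norm_le h2; apply: le_trans H1 _.
  by have := ler_wpM2l t1' le; lra.
apply: qball_norm_le h1; apply: le_trans H1 _.
by have := ler_wpM2l t0 le; lra.
Qed.

Lemma qball_pt r I J x y : imag_units I -> imag_units J ->
  qball r (slice_pt I x y) -> qball r (slice_pt J x y).
Proof. by move=> uI uJ; apply: qball_norm_le; rewrite (pt_normE _ _ uJ uI). Qed.

Lemma semiregular_punctured r S f I x y : imag_units I ->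
  semiregular (qball r) S f -> qball r (slice_pt I x y) ->
  exists2 rho, 0 < rho & forall x' y', box x y rho x' y' -> (x', y') <> (x, y) ->
    (qball r `\` S) (slice_pt I x' y').
Proof.
move=> uI [_ iso [[oD _] _ _] _] Bp.
have [Sp|Sp] := pselect (S (slice_pt I x y)); last first.
  have [rho rho0 H] := nbhs_pt uI (open_nbhs_nbhs (conj oD (conj Bp Sp))).
  by exists rho => // x' y' /H.
have sl x' y' : slice I (slice_pt I x' y') by exists x', y'.
have [_ [V Vp VS]] := iso I uI _ (conj Sp (sl x y)).
have [rho rho0 H] :=
  nbhs_pt uI (filterI Vp (open_nbhs_nbhs (conj (@qball_open r) Bp))).
exists rho => // x' y' /H[Vp' Bp'] ne.
split => // Sp'; apply: ne; apply: (pt_inj uI).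
by have : (V `&` (S `&` slice I)) (slice_pt I x' y') by []; rewrite VS.
Qed.

(** At a real point the derivative of h in x is 0, hence by holomorphy so is its
    whole differential, and cutting preserves the expansion. *)
Lemma holo_cut K h a b rho : holo K (box a b rho) h -> (forall x, h x 0 = 0) ->
  holo K (box a b rho) (fun x y => if 0 < y then h x y else 0).
Proof.
move=> hh h0 x y bxy; have [A dA] := hh _ _ bxy.
have [y0|y0|y0] := ltgtP 0 y.
- exists A => e e0; have [del del0 Hd] := dA e e0.
  exists (Num.min del y); first by rewrite lt_min del0.
  move=> x' y'; rewrite !lt_min => /andP[x1 _] /andP[y1]; rewrite ltr_norml => /andP[y2 _].
  have y'0 : 0 < y' by lra.
  by rewrite y0 y'0; exact: Hd.
- exists 0 => e e0; exists (- y); first by rewrite oppr_gt0.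
  move=> x' y' _; rewrite ltr_norml => /andP[_ y2].
  have -> : (0 < y) = false by apply/negbTE; rewrite -leNgt ltW.
  have -> : (0 < y') = false by apply/negbTE; rewrite -leNgt; lra.
  by rewrite mulr0 !scaler0 !subr0 normr0 mulr_ge0 ?(ltW e0) ?addr_ge0.
- have A0 : A = 0.
    apply: (derive_locally_zero ltr01) (diff2_derive dA) => t _.
    by rewrite -y0; exact: h0.
  rewrite A0 mulr0 in dA; exists 0 => e e0; have [del del0 Hd] := dA e e0.
  exists del => // x' y' x1 y1; have := Hd _ _ x1 y1.
  rewrite mulr0 !scaler0 !subr0 -y0 ltxx h0 subr0 => Hp.
  by case: ifP; rewrite !subr0 in Hp *; rewrite // normr0 => _; exact: le_trans Hp.
Qed.

(** Replacing h by 0 below the axis turns vanishing on the axis into vanishing on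
    an open set, from which it spreads back above the axis. *)
Lemma holo_zero_above K h c rho : imag_units K -> 0 < rho ->
  holo K (box c 0 rho) h -> (forall x, h x 0 = 0) ->
  exists b s, [/\ 0 < s, box c 0 rho c b & forall x y, box c b s x y -> h x y = 0].
Proof.
move=> uK rho0 hh h0; have hcut := holo_cut hh h0.
(* the square of half side rho / 4 around (c, b0) reaches above the axis *)
pose b0 := - (rho / 8).
have r2 : 0 < rho / 2 by lra.
have r8 : 0 < rho / 8 by lra.
have cc : `|c - c| = 0 by rewrite subrr normr0.
have nb0 : `|b0 - 0| = rho / 8 by rewrite subr0 normrN gtr0_norm.
have sub : holo K (box c b0 (rho / 2)) (fun x y => if 0 < y then h x y else 0).
  by apply: holo_sub hcut => x y; apply: box_sub; rewrite ?cc ?nb0; lra.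
have zb x y : box c b0 (rho / 8) x y -> (if 0 < y then h x y else 0) = 0.
  move=> [_]; rewrite ltr_norml /b0 => /andP[_ y1].
  by rewrite ltNge (_ : y <= 0)//; lra.
have z := holo_zero_spread uK r8 r2 sub zb.
exists (rho / 16), (rho / 32); split; first lra.
  by split; rewrite ?cc// subr0 gtr0_norm; lra.
move=> x y [x1 y1]; have := z x y; rewrite /box.
move: y1; rewrite !ltr_norml /b0 => /andP[y1 y2].
rewrite (_ : 0 < y); last lra.
apply; move: x1; rewrite ltr_norml => /andP[x1 x2].
by split; apply/andP; split; lra.
Qed.

(** Both sides are holomorphic functions of x + y K and agree on the real axis, so
    they agree off the points where one of the three slices meets S. *)
Theorem representation r S f I J K x y :
  (0 < r)%E -> semiregular (qball r) S f ->
  imag_units I -> imag_units J -> imag_units K -> I != J ->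
  (qball r `\` S) (slice_pt I x y) -> (qball r `\` S) (slice_pt J x y) ->
  (qball r `\` S) (slice_pt K x y) ->
  f (slice_pt K x y) = rep_coefl K I J * f (slice_pt I x y) + rep_coefr K I J * f (slice_pt J x y).
Proof.
move=> r0 sf uI uJ uK IJ DI DJ DK.
have [_ _ reg _] := sf.
pose D x y := [/\ (qball r `\` S) (slice_pt I x y), (qball r `\` S) (slice_pt J x y) &
  (qball r `\` S) (slice_pt K x y)].
(* the difference of the two sides *)
pose h x y := f (slice_pt K x y) + (- rep_coefl K I J * f (slice_pt I x y) + - rep_coefr K I J * f (slice_pt J x y)).
suff : h x y = 0.
  by rewrite /h !mulNr -opprD => /eqP; rewrite subr_eq0 => /eqP.
have hh : holo K D h.
  move=> x' y' [D1 D2 D3].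
  have [A1 d1] := regular_diff2 uI reg D1; have [A2 d2] := regular_diff2 uJ reg D2.
  have [A3 d3] := regular_diff2 uK reg D3.
  exists (A3 + (- rep_coefl K I J * A1 + - rep_coefr K I J * A2)).
  have -> : K * (A3 + (- rep_coefl K I J * A1 + - rep_coefr K I J * A2)) =
    K * A3 + (- rep_coefl K I J * (I * A1) + - rep_coefr K I J * (J * A2)).
    rewrite !mulrDr !mulNr !mulrN !mulrA; congr (_ + (- _ + - _)).
      by rewrite rep_coefl_intertwine// /rep_coefl !mulrA.
    by rewrite rep_coefr_intertwine// /rep_coefr !mulrA.
  by apply: diff2D => //; apply: diff2D; exact: diff2_mull.
have h0 x' : h x' 0 = 0.
  rewrite /h !pt0 !mulNr -opprD -mulrDl rep_sum// mul1r subrr//.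
have disc x' y' : qball r (slice_pt I x' y') -> exists2 rho, 0 < rho & forall x'' y'',
    box x' y' rho x'' y'' -> (x'', y'') <> (x', y') -> D x'' y''.
  move=> BI; have BJ := qball_pt uI uJ BI; have BK := qball_pt uI uK BI.
  have [r1 r10 H1] := semiregular_punctured uI sf BI.
  have [r2 r20 H2] := semiregular_punctured uJ sf BJ.
  have [r3 r30 H3] := semiregular_punctured uK sf BK.
  exists (Num.min r1 (Num.min r2 r3)); first by rewrite !lt_min r10 r20.
  move=> x'' y'' [bx by_] ne; move: bx by_; rewrite !lt_min.
  move=> /and3P[x1 x2 x3] /and3P[y1 y2 y3].
  by split; [apply: H1|apply: H2|apply: H3].
have B0 : qball r (slice_pt I 0 0) by rewrite /qball /= pt0 scale0r normr0.
have [rho rho0 Hrho] := disc _ _ B0.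
have rho2 : 0 < rho / 2 by lra.
have hpos : holo K (box (rho / 2) 0 (rho / 2)) h.
  apply: holo_sub hh => x' y' [+ y1]; rewrite ltr_norml => /andP[x1 x2].
  apply: Hrho; last by case; lra.
  split; first by rewrite subr0 ltr_norml; apply/andP; split; lra.
  by apply: lt_trans y1 _; lra.
have [b [s [s0 bb z]]] := holo_zero_above uK rho2 hpos h0.
have Bc : qball r (slice_pt I (rho / 2) b).
  case: bb => _; rewrite subr0 => bb; have [] := Hrho (rho / 2) b.
  - by split; rewrite subr0 ?(gtr0_norm rho2); [lra|apply: lt_trans bb _; lra].
  - by case; lra.
  - by case.
apply: (identity_off_discrete uK (@qball_convex r I) hh disc Bc s0).
- by move=> x' y' b' _; exact: z.
- by case: DI.
- by [].
Qed.

End Representation.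

(** * Differentiability of quaternionic functions *)

Lemma connected_between (T : topologicalType) (A B : set T) :
  connected A -> A `<=` B -> B `<=` closure A -> connected B.
Proof.
move=> cA AB BA E [e Ee] [C oC EC] [C' cC' EC'].
have AE : A `&` E = A.
  apply: cA.
  - have [Be Ce] : (B `&` C) e by rewrite -EC.
    have [a [Aa Ca]] := BA e Be C (open_nbhs_nbhs (conj oC Ce)).
    by exists a; split => //; rewrite EC; split => //; exact: AB.
  - by exists C => //; rewrite EC setIA (setIidl AB).
  - by exists C' => //; rewrite EC' setIA (setIidl AB).
apply/seteqP; split; first by rewrite EC => x [].
move=> x Bx; rewrite EC'; split => //.
have /closure_id -> := cC'; apply: closureS (BA x Bx) => a Aa.
by have : (A `&` E) a by [rewrite AE]; rewrite EC' => -[_ []].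
Qed.

Lemma near_eq_differentiable (R : numFieldType) (V W : normedModType R) (f g : V -> W) x :
  (\forall y \near x, f y = g y) -> differentiable f x -> differentiable g x.
Proof.
move=> fg df.
have E : g \o shift x = cst (g x) + 'd f x +o_ 0 id.
  apply/eqaddoP => e e0; have /eqaddoP Hf := diff_locally df.
  have fgx : f x = g x by exact: nbhs_singleton fg.
  have fg0 : \forall h \near (0 : V), f (h + x) = g (h + x).
    have /(_ _ fg) : (fun h : V => h + x) @ (0 : V) --> x.
      by rewrite -[X in _ --> X]add0r; apply: cvgD; [exact: cvg_id|exact: cvg_cst].
    exact.
  by apply: filterS2 fg0 (Hf e e0) => h hE; rewrite /= !fctE /= hE fgx.
have dE := diff_unique (diff_continuous df) E.
by apply/diff_locallyP; rewrite dE; split => //; exact: diff_continuous.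
Qed.

Section QuatDifferentiable.
Variable R : realType.
Local Notation H := (quat R).
Implicit Types (V : normedModType R) (p q I J K : H) (x y a b c d e rho : R).

Lemma coord_differentiable (pr : H -> R) q : is_coord pr -> differentiable pr q.
Proof.
move=> c; have [hD hZ hl] := c.
have lin : GRing.linear_for *%R pr by move=> a u v; rewrite hD hZ.
pose L := GRing.isLinear.Build R H R *%R pr lin.
pose f : {linear H -> R} := HB.pack pr L.
have -> : pr = f by [].
apply: linear_differentiable => p; apply/(@cvgrPdist_le _ _ _ (nbhs p)) => e e0.
apply/nbhs_ballP; exists e => //= p'; rewrite -ball_normE /= => pp.
by rewrite -coordB//; apply: le_trans (hl _) (ltW pp).
Qed.

Lemma quat_differentiable V (f : V -> H) v :
  differentiable (fun z => qr (f z)) v -> differentiable (fun z => qi (f z)) v ->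
  differentiable (fun z => qj (f z)) v -> differentiable (fun z => qk (f z)) v ->
  differentiable f v.
Proof.
move=> d1 d2 d3 d4.
have -> : f = (fun z => qr (f z) *: (Quat 1 0 0 0 : H)) + (fun z => qi (f z) *: (Quat 0 1 0 0 : H))
  + (fun z => qj (f z) *: (Quat 0 0 1 0 : H)) + (fun z => qk (f z) *: (Quat 0 0 0 1 : H)).
  by apply/funext => z; rewrite !fctE; apply: quat_eqP => /=; ring.
by do 3?apply: differentiableD; apply: differentiableZl.
Qed.

Lemma coord_comp_differentiable V (pr : H -> R) (f : V -> H) v : is_coord pr ->
  differentiable f v -> differentiable (fun z => pr (f z)) v.
Proof.
by move=> c df; apply: (differentiable_comp df); exact: coord_differentiable.
Qed.

Lemma differentiable_qmul V (f g : V -> H) v :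
  differentiable f v -> differentiable g v -> differentiable (fun z => f z * g z) v.
Proof.
move=> df dg.
have M pr pr' : is_coord pr -> is_coord pr' ->
    differentiable (fun z => pr (f z) * pr' (g z)) v.
  by move=> c c'; apply: differentiableM; exact: coord_comp_differentiable.
by apply: quat_differentiable => /=;
  repeat (apply: differentiableB || apply: differentiableD); apply: M.
Qed.

Lemma differentiable_qscale V (k : V -> R) (f : V -> H) v :
  differentiable k v -> differentiable f v -> differentiable (fun z => k z *: f z) v.
Proof.
by move=> dk df; apply: quat_differentiable => /=; apply: differentiableM => //;
  exact: coord_comp_differentiable.
Qed.

Definition im_part q : H := Quat 0 (qi q) (qj q) (qk q).
Definition im_norm q : R := `|im_part q|.

Lemma im_partB p q : im_part (p - q) = im_part p - im_part q.
Proof. by apply: quat_eqP => /=; rewrite ?subrr. Qed.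

Lemma re_im_partE q : q = (qr q)%:A + im_part q.
Proof. by apply: quat_eqP => /=; ring. Qed.

Lemma im_part_sqr q : im_part q * im_part q = - (im_norm q ^+ 2)%:A.
Proof.
rewrite /im_norm qnorm_sqr /qsqnorm; apply: quat_eqP => /=; ring.
Qed.

Lemma im_norm_ge0 q : 0 <= im_norm q.
Proof. exact: normr_ge0. Qed.

Lemma im_norm_lipschitz p q : `|im_norm p - im_norm q| <= `|p - q|.
Proof.
apply: le_trans (ler_dist_dist _ _) _; rewrite -im_partB.
rewrite -(@ler_pXn2r _ 2) ?nnegrE// !qnorm_sqr /qsqnorm /=.
by rewrite expr0n /= add0r -!addrA lerDr sqr_ge0.
Qed.

Lemma qr_lipschitz p q : `|qr p - qr q| <= `|p - q|.
Proof. by rewrite -coordB//; have [_ _ h] := coord_qr R; exact: h. Qed.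

Lemma im_part_unit q : im_norm q != 0 -> imag_units ((im_norm q)^-1 *: im_part q).
Proof.
move=> n0; rewrite /imag_units /= expr2 -scalerAl -scalerAr im_part_sqr scalerA.
rewrite scalerN scalerA (_ : _ * _ = 1) ?scale1r//.
by field.
Qed.

Lemma quat_i_unit : imag_units (Quat 0 1 0 0 : H).
Proof. by rewrite /imag_units /= expr2; apply: quat_eqP => /=; ring. Qed.

Lemma pt_surj q : exists2 I, imag_units I & q = slice_pt I (qr q) (im_norm q).
Proof.
have [n0|n0] := eqVneq (im_norm q) 0.
  exists (Quat 0 1 0 0); first exact: quat_i_unit.
  rewrite n0 pt0 {1}(re_im_partE q); move/eqP: n0; rewrite normr_eq0 => /eqP ->.
  by rewrite addr0.
exists ((im_norm q)^-1 *: im_part q); first exact: im_part_unit.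
by rewrite /slice_pt scalerA mulfV// scale1r -re_im_partE.
Qed.

Lemma im_norm_pt I x y : imag_units I -> im_norm (slice_pt I x y) = `|y|.
Proof.
move=> uI; have [r0 _] := imag_unitP uI.
rewrite /im_norm (_ : im_part _ = y *: I); first by rewrite normrZ imag_unit_norm// mulr1.
by apply: quat_eqP; rewrite /slice_pt /= ?r0; ring.
Qed.

Lemma im_norm_differentiable q : im_norm q != 0 -> differentiable im_norm q.
Proof.
move=> n0.
pose N := fun p : H => qi p * qi p + qj p * qj p + qk p * qk p.
have dN : differentiable N q.
  have M pr : is_coord pr -> differentiable (fun p : H => pr p * pr p) q.
    by move=> c; apply: differentiableM; exact: coord_differentiable.
  by apply: differentiableD; [apply: differentiableD|]; apply: M.
have E p : im_norm p = Num.sqrt (N p).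
  by rewrite /im_norm -[LHS]ger0_norm// -sqrtr_sqr qnorm_sqr /qsqnorm /N /= expr0n add0r !expr2.
have Npos : 0 < N q.
  have : 0 < im_norm q by rewrite lt_neqAle eq_sym n0 im_norm_ge0.
  by rewrite E sqrtr_gt0.
have -> : im_norm = Num.sqrt \o N by apply/funext => p; exact: E.
apply: differentiable_comp => //; apply/derivable1_diffP.
have := is_derive1_sqrt Npos => ds; exact: ex_derive.
Qed.

End QuatDifferentiable.

(** * The regular extension *)

Section Extension.
Variable R : realType.
Local Notation H := (quat R).
Implicit Types (p q I J K A B : H) (x y a b c d e t rho C : R).
Implicit Types (r : \bar R) (S D : set H) (f : H -> H).

Lemma qnormV q : q != 0 -> `|q^-1| = `|q|^-1.
Proof.
move=> q0; have n0 : `|q| != 0 by rewrite normr_eq0.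
by apply: (mulfI n0); rewrite -qnormM mulfV// divrr ?qnorm1.
Qed.

(** Conjugation by 1 + t L moves a unit I continuously off itself as soon as L
    does not commute with I. *)
Lemma exists_near_unit I e : imag_units I -> 0 < e ->
  exists J, [/\ imag_units J, I != J & `|J - I| < e].
Proof.
move=> uI e0; have [r0 n1] := imag_unitP uI.
have [L [uL LI]] : exists L, imag_units L /\ L * I != I * L.
  have [k0|k0] := eqVneq (qk I) 0; last first.
    exists (Quat 0 1 0 0); split; first exact: quat_i_unit.
    apply/eqP => E; move/eqP: k0; apply; move/(congr1 (@qj R)): E => /=.
    by rewrite r0; lra.
  have [j0|j0] := eqVneq (qj I) 0; last first.
    exists (Quat 0 1 0 0); split; first exact: quat_i_unit.
    apply/eqP => E; move/eqP: j0; apply; move/(congr1 (@qk R)): E => /=.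
    by rewrite r0; lra.
  exists (Quat 0 0 1 0); split.
    by rewrite /imag_units /= expr2; apply: quat_eqP => /=; ring.
  apply/eqP => E; move/(congr1 (@qk R)): E => /=; rewrite r0 => E.
  have i0 : qi I = 0 by lra.
  by move: n1; rewrite i0 j0 k0 expr0n /= !addr0 => /eqP; rewrite eq_sym oner_eq0.
pose t := e / 4; pose u := 1 + t *: L.
have t0 : 0 < t by rewrite divr_gt0.
have uE : u = slice_pt L 1 t by rewrite /slice_pt scale1r.
have u2 : `|u| ^+ 2 = 1 + t ^+ 2 by rewrite uE pt_norm// expr1n.
have u1 : 1 <= `|u|.
  by rewrite -(@ler_pXn2r _ 2) ?nnegrE// u2 expr1n lerDl sqr_ge0.
have u0 : u != 0 by rewrite -normr_eq0 gt_eqF// (lt_le_trans _ u1).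
have uu : u \is a GRing.unit by rewrite unfold_in.
have comm : u * I - I * u = t *: (L * I - I * L).
  by rewrite /u mulrDl mulrDr mul1r mulr1 -scalerAl -scalerAr scalerBr opprD addrACA subrr add0r.
have E : u * I / u - I = (t *: (L * I - I * L)) / u.
  by rewrite -comm mulrBl -mulrA [I * u / u]mulrK// mulrA.
exists (u * I / u); split.
- rewrite /imag_units /= expr2 !mulrA mulrVK// -[u * I * I]mulrA imag_unit_sqr//.
  by rewrite mulrN1 mulNr divrr.
- apply/eqP => EI; move: E; rewrite -EI subrr => /(congr1 (fun z => z * u)).
  rewrite mulrVK// mul0r => /esym/eqP.
  by rewrite scaler_eq0 gt_eqF//= subr_eq0 (negbTE LI).
- rewrite E qnormM qnormV// normrZ (gtr0_norm t0).
  have n2 : `|L * I - I * L| <= 2.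
    by apply: le_trans (ler_normB _ _) _; rewrite !qnormM !imag_unit_norm//; lra.
  rewrite ltr_pdivrMr ?(lt_le_trans _ u1)//.
  have : t * `|L * I - I * L| <= t * 2 by rewrite ler_pM2l.
  by have : e * 1 <= e * `|u| by [rewrite ler_pM2l]; rewrite /t; lra.
Qed.

Lemma exists_second_unit D I x y : open D -> imag_units I -> D (slice_pt I x y) ->
  exists J, [/\ imag_units J, I != J & D (slice_pt J x y)].
Proof.
move=> oD uI /(conj oD)/open_nbhs_nbhs/nbhs_ballP[e /= e0 eD].
have m0 : 0 < `|y| + 1 by rewrite ltr_wpDl.
have [J [uJ IJ JI]] := exists_near_unit uI (divr_gt0 e0 m0).
exists J; split => //; apply: eD; rewrite -ball_normE /=.
rewrite (_ : slice_pt I x y - slice_pt J x y = y *: (I - J)); last first.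
  by rewrite /slice_pt opprD addrACA subrr add0r -scalerBr.
rewrite normrZ distrC; move: JI; rewrite ltr_pdivlMr// => JI.
have := normr_ge0 (J - I); have := normr_ge0 y; lra.
Qed.

(** The value of the formula is affine in the unit K, which makes comparing
    different pairs I, J easy. *)
Lemma rep_combination I J K A B : I != J ->
  rep_coefl K I J * A + rep_coefr K I J * B = A + (K - I) * ((I - J)^-1 * (A - B)).
Proof.
move=> IJ; have -> : rep_coefl K I J = 1 + (K - I) * (I - J)^-1.
  rewrite -(divrr (subr_unit IJ)) -mulrDl /rep_coefl; congr (_ / _).
  by rewrite [RHS]addrC addrA subrK.
have -> : rep_coefr K I J = - ((K - I) * (I - J)^-1) by rewrite /rep_coefr -mulNr opprB.
by rewrite mulrDl mul1r mulNr -addrA -mulrBr mulrA.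
Qed.

Definition rep f x y I J K :=
  rep_coefl K I J * f (slice_pt I x y) + rep_coefr K I J * f (slice_pt J x y).

Lemma rep_affine f x y I J K : I != J -> rep f x y I J K =
  f (slice_pt I x y) + (K - I) * ((I - J)^-1 * (f (slice_pt I x y) - f (slice_pt J x y))).
Proof. exact: rep_combination. Qed.

Lemma repN f x y I J K : rep f x (- y) (- I) (- J) (- K) = rep f x y I J K.
Proof.
have e (a b : H) : - a - - b = - (a - b) by rewrite opprD.
by rewrite /rep /rep_coefl /rep_coefr !ptN !e !invrN !mulrNN opprK.
Qed.

Section Fixed.
Variables (r : \bar R) (S : set H) (f : H -> H).
Hypothesis (r0 : (0 < r)%E) (sf : semiregular (qball r) S f).

Let D := qball r `\` S.

Let D_open : open D.
Proof. by have [_ _ [[]]] := sf. Qed.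

(** The largest union of whole spheres and real points contained in S. A sphere
    outside it carries a point off S, hence, S being relatively closed, two of
    them, and these determine the function near the whole sphere. *)
Definition sym_core : set H :=
  [set q | forall I, imag_units I -> S (slice_pt I (qr q) (im_norm q))].

Lemma sym_coreP K x y : imag_units K ->
  sym_core (slice_pt K x y) <-> forall I, imag_units I -> S (slice_pt I x y).
Proof.
move=> uK; rewrite /sym_core /mkset qr_pt// im_norm_pt//.
have [y0|y0] := leP 0 y; first by rewrite ger0_norm.
by rewrite ltr0_norm//; split=> h I uI; have := h _ (imag_unitN uI); rewrite ptN ?opprK.
Qed.

Lemma sym_core_sub : sym_core `<=` S.
Proof. by move=> q Tq; have [I uI ->] := pt_surj q; exact: Tq. Qed.

Lemma sym_core_qball : sym_core `<=` qball r.
Proof. by move=> q /sym_core_sub; have [h _ _ _] := sf; exact: h. Qed.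

Lemma not_sym_core K x y : imag_units K -> qball r (slice_pt K x y) ->
  ~ sym_core (slice_pt K x y) -> exists I J,
  [/\ imag_units I, imag_units J, I != J, D (slice_pt I x y) & D (slice_pt J x y)].
Proof.
move=> uK Bp /(sym_coreP _ _ uK)/existsNP[I /not_implyP[uI nS]].
have DI : D (slice_pt I x y) by split => //; exact: qball_pt Bp.
have [J [uJ IJ DJ]] := exists_second_unit D_open uI DI.
by exists I, J.
Qed.

Let rep_rel q v := exists x y I J K, [/\ imag_units I, imag_units J & imag_units K] /\
  [/\ I != J, D (slice_pt I x y), D (slice_pt J x y), q = slice_pt K x y & v = rep f x y I J K].

(** By the representation formula both pairs of units read off the same affine
    function of K. *)
Lemma rep_indep x y I J I' J' K : imag_units I -> imag_units J -> imag_units I' ->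
  imag_units J' -> I != J -> I' != J' -> D (slice_pt I x y) -> D (slice_pt J x y) ->
  D (slice_pt I' x y) -> D (slice_pt J' x y) -> rep f x y I' J' K = rep f x y I J K.
Proof.
move=> uI uJ uI' uJ' IJ IJ' DI DJ DI' DJ'.
have EI : f (slice_pt I' x y) = rep f x y I J I' by exact: (representation r0 sf).
have EJ : f (slice_pt J' x y) = rep f x y I J J' by exact: (representation r0 sf).
rewrite rep_affine// EI EJ !rep_affine//.
set a := f (slice_pt I x y); set B := _ * (a - _).
have -> : a + (I' - I) * B - (a + (J' - I) * B) = (I' - J') * B.
  by rewrite opprD addrACA subrr add0r -mulrBl opprB addrA subrK.
rewrite mulKr ?subr_unit// -addrA -mulrDl.
by rewrite (_ : I' - I + (K - I') = K - I)// [LHS]addrC addrA subrK.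
Qed.

Lemma rep_rel_unique q v w : rep_rel q v -> rep_rel q w -> v = w.
Proof.
move=> [x [y [I [J [K [[uI uJ uK] [IJ DI DJ -> ->]]]]]]].
move=> [x' [y' [I' [J' [K' [[uI' uJ' uK'] [IJ' DI' DJ' E ->]]]]]]].
have xx : x = x' by have := congr1 (@qr R) E; rewrite !qr_pt.
have yy : `|y| = `|y'| by have := congr1 (@im_norm R) E; rewrite !im_norm_pt.
subst x'.
have yK : y *: K = y' *: K' by move: E; rewrite /slice_pt => /addrI.
have [y0|y0] := eqVneq y 0.
  have y'0 : y' = 0 by apply/eqP; rewrite -normr_eq0 -yy y0 normr0.
  have e L M (u : H) : L != M -> rep_coefl K L M * u + rep_coefr K L M * u = u.
    by move=> LM; rewrite -mulrDl rep_sum// mul1r.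
  have e' L M (u : H) : L != M -> rep_coefl K' L M * u + rep_coefr K' L M * u = u.
    by move=> LM; rewrite -mulrDl rep_sum// mul1r.
  by rewrite /rep y0 y'0 !pt0 e// e'.
have [yy'|yy'] : y' = y \/ y' = - y.
  by move/eqP: yy; rewrite eqr_norm2 => /orP[/eqP ->|/eqP ->]; [left|right; rewrite opprK].
- subst y'; have KK := scalerI y0 yK; subst K'.
  by apply: esym; exact: rep_indep.
- have KK : K = - K'.
    by apply: (scalerI y0); rewrite yK yy' scaleNr scalerN.
  have {}KK : K' = - K by rewrite KK opprK.
  rewrite KK yy' -[I']opprK -[J']opprK repN.
  apply: esym; apply: rep_indep => //; try exact: imag_unitN.
  + by rewrite eqr_opp.
  + by rewrite ptN -yy'.
  + by rewrite ptN -yy'.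
Qed.

(** The value read off from any two regular points of the sphere of q; the choice
    is immaterial by rep_rel_unique. *)
Definition extension q : H := xget 0 (rep_rel q).

Lemma extension_rep x y I J K : imag_units I -> imag_units J -> imag_units K ->
  I != J -> D (slice_pt I x y) -> D (slice_pt J x y) -> extension (slice_pt K x y) = rep f x y I J K.
Proof.
move=> uI uJ uK IJ DI DJ.
have h : rep_rel (slice_pt K x y) (rep f x y I J K) by exists x, y, I, J, K.
rewrite /extension; case: xgetP => [v _ hv|/(_ _ h)//].
exact: rep_rel_unique hv h.
Qed.

Lemma extension_extends q : D q -> extension q = f q.
Proof.
have [K uK qE] := pt_surj q => Dq; rewrite qE in Dq *.
have [J [uJ KJ DJ]] := exists_second_unit D_open uK Dq.
by rewrite (@extension_rep _ _ K J)// rep_affine// subrr mul0r addr0.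
Qed.

Lemma D_sub : D `<=` qball r `\` sym_core.
Proof. by move=> q [Bq Sq]; split => // /sym_core_sub. Qed.

Let slice_proj I q := slice_pt I (qr q) (im_norm q).

Lemma slice_proj_lipschitz I p q : imag_units I -> `|slice_proj I p - slice_proj I q| <= 2 * `|p - q|.
Proof.
move=> uI; rewrite /slice_proj ptB; apply: le_trans (pt_norm_le _ _ uI) _.
by have := qr_lipschitz p q; have := im_norm_lipschitz p q; lra.
Qed.

Lemma slice_proj_near I q : imag_units I -> D (slice_proj I q) -> \forall p \near q, D (slice_proj I p).
Proof.
move=> uI /(conj D_open)/open_nbhs_nbhs/nbhs_ballP[e /= e0 eD].
apply/nbhs_ballP; exists (e / 2) => /=; first by rewrite divr_gt0.
move=> p; rewrite -ball_normE /= => qp; apply: eD; rewrite -ball_normE /=.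
by apply: le_lt_trans (slice_proj_lipschitz _ _ uI) _; lra.
Qed.

Lemma complement_open : open (qball r `\` sym_core).
Proof.
rewrite openE => q [Bq nT]; have [K uK qE] := pt_surj q.
have [I [J [uI _ _ DI _]]] : exists I J,
    [/\ imag_units I, imag_units J, I != J, D (slice_proj I q) & D (slice_proj J q)].
  by apply: (not_sym_core uK); rewrite -qE.
have Bn : \forall p \near q, qball r p by exact: open_nbhs_nbhs (conj (@qball_open _ r) Bq).
apply: filterS2 Bn (slice_proj_near uI DI) => p Bp [_ nS]; split => // /(_ I uI).
exact: nS.
Qed.

(** S has no interior in any slice, so the complement of S is dense in the larger
    set. *)
Lemma complement_connected : connected (qball r `\` sym_core).
Proof.
have [_ _ [[_ cD] _ _] _] := sf.
apply: connected_between cD D_sub _ => q [Bq _] V /nbhs_ballP[e /= e0 eV].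
have [K uK qE] := pt_surj q; rewrite qE in Bq.
have [rho rho0 H] := semiregular_punctured uK sf Bq.
pose t := Num.min rho e / 2.
have m1 : Num.min rho e <= rho by rewrite ge_min lexx.
have m2 : Num.min rho e <= e by rewrite ge_min lexx orbT.
have t0 : 0 < t by rewrite divr_gt0// lt_min rho0.
have te : t < e by rewrite /t; lra.
have tr : t < rho by rewrite /t; lra.
exists (slice_pt K (qr q + t) (im_norm q)); split.
  apply: H; last by case; lra.
  by split; rewrite ?subrr ?normr0// addrAC subrr add0r gtr0_norm.
apply: eV; rewrite -ball_normE /= {1}qE ptB subrr pt0 normrZ qnorm1 mulr1.
by rewrite opprD addrA subrr add0r normrN gtr0_norm.
Qed.

(** Near a real point the extension is f itself. Elsewhere the formula with fixed
    I and J expresses it through f, real part, modulus and direction of the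
    imaginary part, all differentiable off the real axis. *)
Lemma extension_differentiable q : (qball r `\` sym_core) q -> differentiable extension q.
Proof.
move=> [Bq nT]; have [K uK qE] := pt_surj q.
have [I [J [uI uJ IJ DI DJ]]] : exists I J,
    [/\ imag_units I, imag_units J, I != J, D (slice_proj I q) & D (slice_proj J q)].
  by apply: (not_sym_core uK); rewrite -qE.
have [_ _ [_ df _] _] := sf.
have [n0|n0] := eqVneq (im_norm q) 0.
  have Dq : D q by move: DI; rewrite /slice_proj n0 pt0 -(pt0 K) -n0 -qE.
  apply: near_eq_differentiable (df _ Dq).
  have : \forall p \near q, D p by exact: open_nbhs_nbhs.
  by apply: filterS => p /extension_extends.
have near_n0 : \forall p \near q, im_norm p != 0.
  have npos : 0 < im_norm q by rewrite lt_neqAle eq_sym n0 im_norm_ge0.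
  apply/nbhs_ballP; exists (im_norm q) => //= p; rewrite -ball_normE /= => qp.
  have := im_norm_lipschitz q p; case: eqP => // ->.
  by rewrite subr0 ger0_norm ?im_norm_ge0//; lra.
pose k p := (im_norm p)^-1 *: im_part p.
pose a p := f (slice_proj I p); pose b p := f (slice_proj J p).
have E : \forall p \near q, a p + (k p - I) * ((I - J)^-1 * (a p - b p)) = extension p.
  apply: filterS3 near_n0 (slice_proj_near uI DI) (slice_proj_near uJ DJ) => p np DpI DpJ.
  have pE : p = slice_pt (k p) (qr p) (im_norm p).
    by rewrite /slice_pt /k scalerA mulfV// scale1r -re_im_partE.
  by rewrite [in RHS]pE (extension_rep uI uJ (im_part_unit np) IJ DpI DpJ) rep_affine.
apply: near_eq_differentiable E _.
have dn := im_norm_differentiable n0.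
have dsp L : differentiable (slice_proj L) q.
  rewrite /slice_proj /slice_pt; apply: differentiableD; apply: differentiableZl => //.
  exact: (coord_differentiable _ (coord_qr R)).
have da : differentiable a q by apply: (differentiable_comp (dsp I)); exact: df.
have db : differentiable b q by apply: (differentiable_comp (dsp J)); exact: df.
have dk : differentiable k q.
  apply: differentiable_qscale; first exact: differentiableV.
  apply: quat_differentiable => /=; first exact: differentiable_cst.
  - exact: (coord_differentiable _ (coord_qi R)).
  - exact: (coord_differentiable _ (coord_qj R)).
  - exact: (coord_differentiable _ (coord_qk R)).
apply: differentiableD => //; apply: differentiable_qmul.
  by apply: differentiableB => //; exact: differentiable_cst.
apply: differentiable_qmul; first exact: differentiable_cst.
exact: differentiableB.
Qed.

Lemma diff2_local (h1 h2 : R -> R -> H) x y rho (A B : H) : 0 < rho ->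
  (forall x' y', box x y rho x' y' -> h1 x' y' = h2 x' y') ->
  diff2 h1 x y A B -> diff2 h2 x y A B.
Proof.
move=> rho0 h12 D1 e e0; have [del del0 Hd] := D1 e e0.
exists (Num.min rho del); first by rewrite lt_min rho0.
move=> x' y'; rewrite !lt_min => /andP[x1 x2] /andP[y1 y2].
rewrite -!h12; first exact: Hd.
- by split; rewrite subrr normr0.
- by split.
Qed.

Lemma extension_dbar K x y : imag_units K -> (qball r `\` sym_core) (slice_pt K x y) ->
  dbar K extension x y = 0.
Proof.
move=> uK [Bp nT]; have [I [J [uI uJ IJ DI DJ]]] := not_sym_core uK Bp nT.
have [_ _ reg _] := sf.
have [A1 d1] := regular_diff2 uI reg DI; have [A2 d2] := regular_diff2 uJ reg DJ.
have [r1 r10 H1] := nbhs_pt uI (open_nbhs_nbhs (conj D_open DI)).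
have [r2 r20 H2] := nbhs_pt uJ (open_nbhs_nbhs (conj D_open DJ)).
have rm : 0 < Num.min r1 r2 by rewrite lt_min r10.
have m1 : Num.min r1 r2 <= r1 by rewrite ge_min lexx.
have m2 : Num.min r1 r2 <= r2 by rewrite ge_min lexx orbT.
have drep := diff2D (diff2_mull (rep_coefl K I J) d1) (diff2_mull (rep_coefr K I J) d2).
have dext := diff2_local (h2 := fun s t => extension (slice_pt K s t)) rm _ drep.
rewrite (dbar_diff2 (dext _)); last first.
  move=> x' y' bxy; rewrite (extension_rep uI uJ uK IJ)//.
    by apply: H1; exact: boxW bxy.
  by apply: H2; exact: boxW bxy.
rewrite !mulrA rep_coefl_intertwine// rep_coefr_intertwine// -!mulrA -mulrDr imag_unitM//.
by rewrite subrr scaler0.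
Qed.

Lemma extension_regular : regular (qball r `\` sym_core) extension.
Proof.
split; first by split; [exact: complement_open|exact: complement_connected].
  exact: extension_differentiable.
by move=> I uI x y; exact: extension_dbar.
Qed.

Lemma sym_core_sphere q : im_norm q != 0 -> sym_core q ->
  sphere (qr q) (im_norm q) `<=` sym_core.
Proof.
move=> n0 Tq _ [I uI ->]; rewrite -/(slice_pt I _ _); apply/(sym_coreP _ _ uI) => J uJ.
exact: Tq.
Qed.

Lemma sym_core_isolated : isolated_points_or_spheres sym_core.
Proof.
move=> q Tq; have uI := quat_i_unit R; set I := (X in imag_units X) in uI.
have [K uK qE] := pt_surj q.
have Bq : qball r (slice_pt I (qr q) (im_norm q)).
  by apply: (qball_pt uK uI); rewrite -qE; exact: sym_core_qball.
have [rho rho0 Hrho] := semiregular_punctured uI sf Bq.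
have near_eq p : box (qr q) (im_norm q) rho (qr p) (im_norm p) -> sym_core p ->
    (qr p, im_norm p) = (qr q, im_norm q).
  move=> bp Tp; apply: contrapT => /(Hrho _ _ bp)[_]; apply; exact: Tp.
have ball_box p : `|q - p| < rho -> box (qr q) (im_norm q) rho (qr p) (im_norm p).
  move=> qp; split; rewrite distrC; apply: le_lt_trans qp.
    exact: qr_lipschitz.
  exact: im_norm_lipschitz.
have [n0|n0] := eqVneq (im_norm q) 0.
  left; exists (qr q); split; first by rewrite {1}qE n0 pt0.
  split; first exact/mem_set.
  exists (ball q rho); first exact: nbhsx_ballx.
  apply/seteqP; split => [p [+ Tp]|p ->]; last by split => //; exact: ballxx.
  rewrite -ball_normE /= => /ball_box bp; have [qpE npE] := near_eq _ bp Tp.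
  have [L uL ->] := pt_surj p.
  by rewrite qpE npE n0 pt0 -(pt0 K) -n0 -qE.
right; exists (qr q), (im_norm q); split => //.
  by exists K.
exists (interior [set p | box (qr q) (im_norm q) rho (qr p) (im_norm p)]).
  exact: open_interior.
apply/seteqP; split => [p [/interior_subset bp Tp]|p sp].
  have [qpE npE] := near_eq _ bp Tp.
  by have [L uL pE] := pt_surj p; exists L => //; rewrite -qpE -npE.
split; last exact: sym_core_sphere sp.
case: sp => L uL ->; rewrite -/(slice_pt L _ _).
apply/nbhs_ballP; exists rho => //= p'; rewrite -ball_normE /= => hp.
have E1 : qr (slice_pt L (qr q) (im_norm q)) = qr q by rewrite qr_pt.
have E2 : im_norm (slice_pt L (qr q) (im_norm q)) = im_norm q by rewrite im_norm_pt// ger0_norm ?im_norm_ge0.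
split; rewrite distrC.
  by rewrite -E1; exact: le_lt_trans (qr_lipschitz _ _) hp.
by rewrite -[X in `|X - _|]E2; exact: le_lt_trans (im_norm_lipschitz _ _) hp.
Qed.

End Fixed.
End Extension.

(** * Laurent expansions *)

Lemma exists_least (P : nat -> Prop) : (exists n, P n) ->
  exists n, P n /\ forall k, P k -> (n <= k)%N.
Proof.
move=> exP; have exb : exists n, `[< P n >] by have [n Pn] := exP; exists n; exact/asboolP.
case: (ex_minnP exb) => n /asboolP Pn nmin; exists n; split => // k Pk.
by apply: nmin; exact/asboolP.
Qed.

Section Orders.
Variable R : realType.
Local Notation H := (quat R).
Implicit Types (p q I J K A B z w c : H) (x y e t rho C : R) (a b : int -> H).
Implicit Types (r : \bar R) (S D : set H) (f : H -> H).

Lemma cvg_mull (u : nat -> H) (s : H) c : u @ \oo --> s -> (fun n => c * u n) @ \oo --> c * s.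
Proof.
move=> us; apply/(@cvgrPdist_le _ _ _ \oo) => e e0.
have c0 : 0 < `|c| + 1 by rewrite ltr_wpDl.
have /(@cvgrPdist_le _ _ _ \oo)/(_ _ (divr_gt0 e0 c0)) := us.
apply: filterS => n; rewrite ler_pdivlMr// -mulrBr qnormM; have := normr_ge0 (s - u n).
by have := normr_ge0 c; lra.
Qed.

Lemma bilateral_sum_comb (u v : int -> H) s s' c c' :
  bilateral_sum u s -> bilateral_sum v s' ->
  bilateral_sum (fun n => c * u n + c' * v n) (c * s + c' * s').
Proof.
move=> [s1 [s2 [u1 u2 ->]]] [t1 [t2 [v1 v2 ->]]].
exists (c * s1 + c' * t1), (c * s2 + c' * t2); split; last first.
- by rewrite !mulrDr addrACA.
- rewrite (_ : series _ = (fun n => c * series (fun n => u (Negz n)) n)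
      + (fun n => c' * series (fun n => v (Negz n)) n)).
    by apply: cvgD; exact: cvg_mull.
  by apply/funext => n; rewrite fctE /series /= big_split /= -!mulr_sumr.
- rewrite (_ : series _ = (fun n => c * series (fun n => u (Posz n)) n)
      + (fun n => c' * series (fun n => v (Posz n)) n)).
    by apply: cvgD; exact: cvg_mull.
  by apply/funext => n; rewrite fctE /series /= big_split /= -!mulr_sumr.
Qed.

Lemma intertwine_pow c w w' (n : int) : w != 0 -> w' != 0 ->
  c * w = w' * c -> c * w ^ n = w' ^ n * c.
Proof.
move=> w0 w'0 cw.
have N (k : nat) : c * w ^+ k = w' ^+ k * c.
  by elim: k => [|k ih]; rewrite ?expr0 ?mulr1 ?mul1r// !exprS mulrA cw -mulrA ih mulrA.
have uw k : w ^+ k \is a GRing.unit by rewrite unitrX// unfold_in.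
have uw' k : w' ^+ k \is a GRing.unit by rewrite unitrX// unfold_in.
case: n => k; first exact: N.
apply: (mulIr (uw k.+1)); rewrite /exprz mulrVK//.
by rewrite -mulrA N mulKr.
Qed.

Lemma rep_coefl_pt K I J x y : imag_units K -> imag_units I -> imag_units J -> I != J ->
  rep_coefl K I J * slice_pt I x y = slice_pt K x y * rep_coefl K I J.
Proof.
move=> uK uI uJ IJ; rewrite /slice_pt mulrDr mulrDl -!scalerAr -!scalerAl mulr1 mul1r.
by rewrite rep_coefl_intertwine.
Qed.

Lemma rep_coefr_pt K I J x y : imag_units K -> imag_units I -> imag_units J -> I != J ->
  rep_coefr K I J * slice_pt J x y = slice_pt K x y * rep_coefr K I J.
Proof. by move=> *; rewrite rep_coefr_swap rep_coefl_pt// eq_sym. Qed.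

Lemma slice_pt_eq I J x y : imag_units I -> imag_units J -> y != 0 ->
  slice J (slice_pt I x y) -> slice J = slice I.
Proof.
move=> uI uJ y0 [x' [y' E]].
have xx : x = x' by have := congr1 (@qr R) E; rewrite -/(slice_pt J x' y') !qr_pt.
have yI : y *: I = y' *: J by move: E; rewrite /slice_pt xx => /addrI.
have y'0 : y' != 0.
  by apply: contra_eq_neq yI => ->; rewrite scale0r scaler_eq0 negb_or y0 -normr_eq0
    imag_unit_norm// oner_eq0.
have JI : J = (y / y') *: I by rewrite mulrC -scalerA yI scalerA mulVf// scale1r.
have IJ : I = (y' / y) *: J by rewrite mulrC -scalerA -yI scalerA mulVf// scale1r.
apply/seteqP; split => q [s [t ->]].
  by exists s, (t * (y / y')); rewrite [in LHS]JI scalerA.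
by exists s, (t * (y' / y)); rewrite [in LHS]IJ scalerA.
Qed.

Lemma semiregular_annulus r S f I x y : imag_units I ->
  semiregular (qball r) S f -> qball r (slice_pt I x y) ->
  exists2 rho, 0 < rho & annulus I (slice_pt I x y) 0 rho `<=` qball r `\` S.
Proof.
move=> uI sf Bp; have [rho rho0 Hr] := semiregular_punctured uI sf Bp.
exists rho => // _ [[x' [y' ->]]]; rewrite -/(slice_pt I x' y') ptB => /andP[z0 zr].
apply: Hr; last by case=> xx yy; move: z0; rewrite xx yy !subrr pt0 scale0r normr0 ltxx.
have n2 := pt_norm (x' - x) (y' - y) uI.
split; apply: le_lt_trans zr.
  by rewrite -(@ler_pXn2r _ 2) ?nnegrE// n2 real_normK ?num_real// lerDl sqr_ge0.
by rewrite -(@ler_pXn2r _ 2) ?nnegrE// n2 real_normK ?num_real// lerDr sqr_ge0.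
Qed.

(** Off the real axis a point lies on a single slice, so the expansion that the
    absence of essential singularities provides on some slice is one on the slice
    of I. *)
Lemma pole_expansion r S f I x y : imag_units I -> y != 0 ->
  semiregular (qball r) S f -> S (slice_pt I x y) -> exists n rho a,
  [/\ 0 < rho, annulus I (slice_pt I x y) 0 rho `<=` qball r `\` S,
    laurent f I (slice_pt I x y) 0 rho a & forall m : nat, (n < m)%N -> a (- m%:Z) = 0].
Proof.
move=> uI y0 sf Sp; have [SB _ _ ess] := sf.
have [rho rho0 ann] := semiregular_annulus uI sf (SB _ Sp).
have slp : slice I (slice_pt I x y) by exists x, y.
have iso : isolated_singularity (qball r `\` S) (slice_pt I x y) by exists I, rho.
have [n [J [rho' [a [uJ slJ [r'0 ann'] la van]]]]] :
    pole (qball r `\` S) f (slice_pt I x y).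
  by apply: contrapT => npole; exact: (ess _ Sp (conj iso npole)).
have E := slice_pt_eq uI uJ y0 slJ.
by exists n, rho', a; split => //; move: ann' la; rewrite /laurent /annulus E.
Qed.

Lemma expr_real t (n : nat) : (t%:A : H) ^+ n = (t ^+ n)%:A.
Proof.
elim: n => [|n ih]; first by rewrite !expr0 scale1r.
by rewrite !exprS ih -scalerAl mul1r scalerA.
Qed.

Lemma invr_real t : t != 0 -> (t%:A : H)^-1 = (t^-1)%:A.
Proof.
move=> t0; have tu : (t%:A : H) \is a GRing.unit.
  by rewrite unfold_in /= scaler_eq0 negb_or t0 oner_eq0.
apply: (mulrI tu); rewrite divrr// -scalerAl mul1r scalerA mulfV// scale1r//.
Qed.

(** Along the real direction the Laurent monomials are real and the points lie in
    every slice through p, so that expansions in different slices of the same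
    point can be compared. *)
Lemma laurent_leading f K p rho a (N : nat) : imag_units K -> slice K p -> 0 < rho ->
  laurent f K p 0 rho a -> (0 < N)%N ->
  (forall m : nat, (N < m)%N -> a (- m%:Z) = 0) ->
  exists C del, 0 < del /\ forall t, 0 < t < del ->
    `|t ^+ N *: f (p + t%:A) - a (- N%:Z)| <= C * t.
Proof.
move=> uK [px [py pE]] rho0 la N0 van.
have inann t : 0 < t < rho -> annulus K p 0 rho (p + t%:A).
  move=> /andP[t0 tr]; split.
    by exists (px + t), py; rewrite pE scalerDl addrAC.
  by rewrite addrAC subrr add0r normrZ qnorm1 mulr1 gtr0_norm// t0.
have term t : 0 < t -> forall n : int, (p + t%:A - p) ^ n * a n = t ^ n *: a n.
  move=> t0 n; rewrite addrAC subrr add0r.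
  case: n => n; first by rewrite /exprz expr_real -scalerAl mul1r.
  by rewrite /exprz expr_real invr_real ?expf_neq0 ?gt_eqF// -scalerAl mul1r.
pose t0 := rho / 2.
have t00 : 0 < t0 by rewrite divr_gt0.
have t0r : t0 < rho by rewrite /t0; lra.
(* the regular part is bounded by a geometric series *)
have [M M0 HM] : exists2 M, 0 <= M & forall n : nat, `|t0 ^+ n *: a (Posz n)| <= M.
  have t0in : 0 < t0 < rho by rewrite t00.
  have [s1 [s2 [c1 _ _]]] := la _ (inann _ t0in).
  have cv : cvgn (series (fun n => (p + t0%:A - p) ^ (Posz n) * a (Posz n))).
    by apply/cvg_ex; exists s1.
  have /cvgr0_norm_le H0 := cvg_series_cvg_0 cv.
  have [n0 _ Hn0] := H0 1 ltr01.
  exists (1 + \sum_(k < n0) `|t0 ^+ k *: a (Posz k)|).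
    by rewrite addr_ge0// sumr_ge0.
  move=> n; have [nn|nn] := leqP n0 n.
    by have := Hn0 n nn; rewrite /= term// => h; apply: le_trans h _; rewrite lerDl sumr_ge0.
  rewrite (bigD1 (Ordinal nn)) //= addrCA lerDl addr_ge0// sumr_ge0//.
pose Sa := \sum_(k < N) `|a (Negz k)|.
exists (Sa + 2 * M), (Num.min 1 (t0 / 2)); split.
  by rewrite lt_min ltr01 divr_gt0.
move=> t /andP[tpos]; rewrite lt_min => /andP[t1 tt0].
have trho : 0 < t < rho by rewrite tpos /=; lra.
have [s1 [s2 [c1 c2 fE]]] := la _ (inann t trho).
have q0 : 0 <= t / t0 by rewrite divr_ge0 ?ltW.
have q1 : t / t0 <= 2^-1 by rewrite ler_pdivrMr//; lra.
have B1 : `|s1| <= 2 * M.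
  have B n : `|series (fun n => (p + t%:A - p) ^ (Posz n) * a (Posz n)) n| <= 2 * M.
    rewrite /series /=; apply: le_trans (ler_norm_sum _ _ _) _.
    apply: (@le_trans _ _ (\sum_(0 <= k < n) M * 2^-1 ^+ k)).
      apply: ler_sum => k _; rewrite term// -[t ^ _]/(t ^+ k) normrZ.
      have -> : t ^+ k = (t / t0) ^+ k * t0 ^+ k by rewrite -exprMn divfK// gt_eqF.
      rewrite normrM -mulrA -normrZ mulrC; apply: ler_pM => //.
      by rewrite (ger0_norm (exprn_ge0 _ q0)) lerXn2r// nnegrE invr_ge0.
    rewrite -mulr_sumr mulrC ler_wpM2r//.
    have -> : \sum_(0 <= k < n) 2^-1 ^+ k = 2 * (1 - 2^-1 ^+ n) :> R.
      elim: n => [|n ih]; first by rewrite big_geq// expr0 subrr mulr0.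
      by rewrite big_nat_recr//= ih exprS; field.
    by rewrite ler_piMr// lerBlDr lerDl exprn_ge0// invr_ge0.
  by apply: (cvgr_to_le (cvg_norm c1)); near=> n; exact: B.
have s2E : s2 = \sum_(k < N) t ^ (Negz k) *: a (Negz k).
  apply: (cvg_unique (@norm_hausdorff _ _) c2); apply: cvg_near_cst.
  exists N => // n /= Nn; rewrite /series /= (big_cat_nat (leq0n N) Nn)//=.
  rewrite [X in _ + X]big_nat_cond [X in _ + X]big1 ?addr0.
    by rewrite big_mkord; apply: eq_bigr => k _; rewrite term.
  move=> k /andP[/andP[Nk _] _]; have := van k.+1 Nk; rewrite -NegzE => ->.
  by rewrite mulr0.
have [N' NE] : exists N', N = N'.+1 by case: (N) N0 => // N' _; exists N'.
have E2 : t ^+ N *: s2 - a (- N%:Z) = \sum_(k < N') (t ^+ (N - k.+1)) *: a (Negz k).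
  rewrite s2E NE scaler_sumr big_ord_recr /= scalerA.
  have -> : t ^+ N'.+1 * t ^ Negz N' = 1.
    by rewrite -[t ^ Negz N']/((t ^+ N'.+1)^-1) mulfV// expf_neq0// gt_eqF.
  rewrite scale1r -NegzE addrK; apply: eq_bigr => k _; rewrite scalerA; congr (_ *: _).
  by rewrite /exprz -expfB ?ltnS ?ltn_ord.
rewrite fE scalerDr -addrA E2 [X in `|X|]addrC.
have t0' := ltW tpos.
have tN (k : nat) : (0 < k)%N -> t ^+ k <= t.
  by case: k => // k _; rewrite exprS ler_piMr// exprn_ile1// ltW.
apply: le_trans (ler_normD _ _) _; rewrite mulrDl; apply: lerD; last first.
  rewrite normrZ mulrC; apply: ler_pM => //.
  by rewrite ger0_norm ?exprn_ge0//; exact: tN.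
apply: le_trans (ler_norm_sum _ _ _) _.
rewrite /Sa mulr_suml NE big_ord_recr /=.
apply: (@le_trans _ _ (\sum_(k < N') `|a (Negz k)| * t)); last by rewrite lerDl mulr_ge0.
apply: ler_sum => k _; rewrite normrZ mulrC ler_wpM2l// ger0_norm ?exprn_ge0//.
by apply: tN; rewrite subn_gt0 ltnS.
Unshelve. all: by end_near. Qed.

Lemma laurent_leading_unique f K K' p rho rho' a a' (N : nat) :
  imag_units K -> imag_units K' -> slice K p -> slice K' p -> 0 < rho -> 0 < rho' ->
  laurent f K p 0 rho a -> laurent f K' p 0 rho' a' -> (0 < N)%N ->
  (forall m : nat, (N < m)%N -> a (- m%:Z) = 0) ->
  (forall m : nat, (N < m)%N -> a' (- m%:Z) = 0) -> a (- N%:Z) = a' (- N%:Z).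
Proof.
move=> uK uK' sK sK' r0 r'0 la la' N0 van van'.
have [C [del [del0 h]]] := laurent_leading uK sK r0 la N0 van.
have [C' [del' [del'0 h']]] := laurent_leading uK' sK' r'0 la' N0 van'.
apply/eqP; rewrite -subr_eq0 -normr_le0.
apply: (@le0_of_le_eps _ _ (`|C| + `|C'|)); first by rewrite addr_ge0.
move=> e e0; pose t := Num.min e (Num.min del del') / 2.
have m0 : 0 < Num.min e (Num.min del del') by rewrite !lt_min e0 del0.
have m1 : Num.min e (Num.min del del') <= e by rewrite ge_min lexx.
have m2 : Num.min e (Num.min del del') <= del by rewrite !ge_min lexx orbT.
have m3 : Num.min e (Num.min del del') <= del' by rewrite !ge_min lexx !orbT.
have t0 : 0 < t by rewrite divr_gt0.
have te : t <= e by rewrite /t; lra.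
have td : 0 < t < del by rewrite t0 /= /t; lra.
have td' : 0 < t < del' by rewrite t0 /= /t; lra.
have := h t td; have := h' t td'; set F := _ *: f _ => i2 i1.
have -> : a (- N%:Z) - a' (- N%:Z) = (F - a' (- N%:Z)) - (F - a (- N%:Z)).
  by rewrite opprB [RHS]addrC addrA subrK.
apply: le_trans (ler_normB _ _) _.
have c1 : C * t <= `|C| * e.
  by apply: le_trans (ler_norm _) _; rewrite normrM ler_pM// gtr0_norm.
have c2 : C' * t <= `|C'| * e.
  by apply: le_trans (ler_norm _) _; rewrite normrM ler_pM// gtr0_norm.
lra.
Qed.

End Orders.

(** * Orders on a sphere *)

Section SphereOrders.
Variable R : realType.
Local Notation H := (quat R).
Implicit Types (p q I J K A B z w c : H) (x y e t rho C : R) (a b : int -> H).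
Implicit Types (r : \bar R) (S D : set H) (f : H -> H).

(** The Laurent coefficients transform like the function itself, because the
    coefficients of the representation formula intertwine the monomials. *)
Lemma laurent_rep r S f I J K x y rho a b : (0 < r)%E ->
  semiregular (qball r) S f -> imag_units I -> imag_units J -> imag_units K -> I != J ->
  annulus I (slice_pt I x y) 0 rho `<=` qball r `\` S ->
  annulus J (slice_pt J x y) 0 rho `<=` qball r `\` S ->
  annulus K (slice_pt K x y) 0 rho `<=` qball r `\` S ->
  laurent f I (slice_pt I x y) 0 rho a -> laurent f J (slice_pt J x y) 0 rho b ->
  laurent f K (slice_pt K x y) 0 rho (fun n => rep_coefl K I J * a n + rep_coefr K I J * b n).
Proof.
move=> r0 sf uI uJ uK IJ aI aJ aK la lb z zK; have [[s [t zE]] zr] := zK.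
have {}zE : z = slice_pt K s t by [].
have n0 L : imag_units L -> `|slice_pt L s t - slice_pt L x y| = `|z - slice_pt K x y|.
  by move=> uL; rewrite zE !ptB; exact: pt_normE.
have inI : annulus I (slice_pt I x y) 0 rho (slice_pt I s t).
  by split; [exists s, t|rewrite n0].
have inJ : annulus J (slice_pt J x y) 0 rho (slice_pt J s t).
  by split; [exists s, t|rewrite n0].
rewrite zE (representation r0 sf uI uJ uK IJ (aI _ inI) (aJ _ inJ)); last first.
  by rewrite -zE; exact: aK.
have := bilateral_sum_comb (rep_coefl K I J) (rep_coefr K I J) (la _ inI) (lb _ inJ).
have nz L : imag_units L -> slice_pt L s t - slice_pt L x y != 0.
  by move=> uL; rewrite -normr_eq0 n0// gt_eqF//; case/andP: zr.
have -> // : (fun n => rep_coefl K I J * ((slice_pt I s t - slice_pt I x y) ^ n * a n) +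
    rep_coefr K I J * ((slice_pt J s t - slice_pt J x y) ^ n * b n)) =
  (fun n => (slice_pt K s t - slice_pt K x y) ^ n * (rep_coefl K I J * a n + rep_coefr K I J * b n)).
have E1 := rep_coefl_pt (s - x) (t - y) uK uI uJ IJ.
have E2 := rep_coefr_pt (s - x) (t - y) uK uI uJ IJ.
rewrite -!ptB in E1 E2.
apply/funext => n; rewrite mulrDr; congr (_ + _).
  by rewrite [LHS]mulrA (intertwine_pow n (nz _ uI) (nz _ uK) E1) -[LHS]mulrA.
by rewrite [LHS]mulrA (intertwine_pow n (nz _ uJ) (nz _ uK) E2) -[LHS]mulrA.
Qed.

Lemma laurent_sub f I p rho rho' a : rho' <= rho ->
  laurent f I p 0 rho a -> laurent f I p 0 rho' a.
Proof.
move=> rr la z [sz /andP[z0 zr]]; apply: la; split => //.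
by rewrite z0 (lt_le_trans zr rr).
Qed.

Lemma annulus_sub I p rho rho' D : rho' <= rho ->
  annulus I p 0 rho `<=` D -> annulus I p 0 rho' `<=` D.
Proof.
move=> rr aD z [sz /andP[z0 zr]]; apply: aD; split => //.
by rewrite z0 (lt_le_trans zr rr).
Qed.

Lemma order_le_has_order D f p n : order_le D f p n ->
  exists m, has_order D f p m /\ (m <= n)%N.
Proof.
move=> on; have [|m [om mmin]] := exists_least (P := order_le D f p); first by exists n.
by exists m; split; [split|exact: mmin].
Qed.

(** With I and J fixed, the coefficient of order -n at x + y K is an affine function
    of K determined by those at x + y I and x + y J. For the least N beyond which
    the latter vanish, if N > 0, it is not identically zero, hence has at most one
    zero among the units K, and that is the exceptional point. *)
Lemma sphere_orders r S f x y : (0 < r)%E -> semiregular (qball r) S f -> y != 0 ->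
  (forall I, imag_units I -> S (slice_pt I x y)) ->
  exists (n m : nat) (p0 : H), [/\ sphere x y p0,
    (forall p, sphere x y p -> p <> p0 -> has_order (qball r `\` S) f p n),
    has_order (qball r `\` S) f p0 m & (m <= n)%N].
Proof.
move=> r0 sf y0 Sxy; set D := qball r `\` S; have [SB _ _ _] := sf.
pose I : H := Quat 0 1 0 0; have uI : imag_units I by exact: quat_i_unit.
have [J [uJ IJ _]] := exists_near_unit uI ltr01.
have [n1 [rho1 [a [rho10 aI la va]]]] := pole_expansion uI y0 sf (Sxy I uI).
have [n2 [rho2 [b [rho20 aJ lb vb]]]] := pole_expansion uJ y0 sf (Sxy J uJ).
pose c K (n : int) := rep_coefl K I J * a n + rep_coefr K I J * b n.
have expansion K : imag_units K -> exists rho,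
    [/\ 0 < rho, annulus K (slice_pt K x y) 0 rho `<=` D & laurent f K (slice_pt K x y) 0 rho (c K)].
  move=> uK; have [rho3 rho30 aK] := semiregular_annulus uK sf (SB _ (Sxy K uK)).
  pose rho := Num.min rho1 (Num.min rho2 rho3).
  have l1 : rho <= rho1 by rewrite ge_min lexx.
  have l2 : rho <= rho2 by rewrite !ge_min lexx orbT.
  have l3 : rho <= rho3 by rewrite !ge_min lexx !orbT.
  exists rho; split; first by rewrite !lt_min rho10 rho20.
    exact: annulus_sub aK.
  apply: (laurent_rep r0 sf uI uJ uK IJ); first exact: annulus_sub aI.
  - exact: annulus_sub aJ.
  - exact: annulus_sub aK.
  - exact: laurent_sub la.
  - exact: laurent_sub lb.
pose P N := forall m, (N < m)%N -> a (- m%:Z) = 0 /\ b (- m%:Z) = 0.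
have [|N [PN Nmin]] := exists_least (P := P).
  exists (maxn n1 n2) => m; rewrite gtn_max => /andP[m1 m2].
  by split; [exact: va|exact: vb].
have cvan K m : (N < m)%N -> c K (- m%:Z) = 0.
  by move=> /PN[a0 b0]; rewrite /c a0 b0 !mulr0 addr0.
have ole K : imag_units K -> order_le D f (slice_pt K x y) N.
  move=> uK; have [rho [rho0 aK lK]] := expansion K uK.
  exists K, rho, (c K); split => //; first by exists x, y.
  exact: cvan.
have good K : imag_units K -> ((0 < N)%N -> c K (- N%:Z) <> 0) ->
    has_order D f (slice_pt K x y) N.
  move=> uK cK; split; first exact: ole.
  move=> k [K' [rho' [a' [uK' slK' [rho'0 _] la' va']]]].
  rewrite leqNgt; apply/negP => kN.
  have N0 : (0 < N)%N by exact: leq_ltn_trans kN.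
  have [rho [rho0 _ lK]] := expansion K uK.
  have slK : slice K (slice_pt K x y) by exists x, y.
  apply: (cK N0); rewrite (laurent_leading_unique uK uK' slK slK' rho0 rho'0 lK la' N0).
  - exact: va'.
  - exact: cvan.
  - by move=> m Nm; apply: va'; exact: ltn_trans Nm.
(* two zeros of the leading coefficient as a function of the unit kill both a and b *)
have one_bad K K' : (0 < N)%N -> c K (- N%:Z) = 0 -> c K' (- N%:Z) = 0 -> K = K'.
  move=> N0; rewrite /c !rep_combination//; set A := a _; set V := _ * (A - _).
  move=> cK cK'; apply: contrapT => KK'.
  have V0 : (K - K') * V = 0.
    by rewrite -(subrr 0) -{1}cK -cK' opprD addrACA subrr add0r -mulrBl opprB addrA subrK.
  have V00 : V = 0.
    apply: (mulrI (subr_unit (_ : K != K'))); first exact/eqP.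
    by rewrite V0 mulr0.
  have A0 : A = 0 by move: cK; rewrite V00 mulr0 addr0.
  have B0 : b (- N%:Z) = 0.
    have /(congr1 (fun u => (I - J) * u)) := V00.
    by rewrite /V mulrA mulrV ?subr_unit// mul1r mulr0 A0 sub0r => /eqP; rewrite oppr_eq0 => /eqP.
  suff : P N.-1 by move=> /Nmin; rewrite -ltnS prednK// ltnn.
  move=> m; rewrite -ltnS prednK// ltnS leq_eqVlt => /orP[/eqP <-|/PN//].
  by split.
have [[K0 [uK0 N0 c0]]|nobad] := pselect (exists K0,
    [/\ imag_units K0, (0 < N)%N & c K0 (- N%:Z) = 0]).
  have [m [om mN]] := order_le_has_order (ole K0 uK0).
  exists N, m, (slice_pt K0 x y); split => //; first by exists K0.
  move=> _ [K uK ->] ne; apply: good => // _ cK; apply: ne.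
  by rewrite (one_bad K K0 N0 cK c0).
have [m [om mN]] := order_le_has_order (ole I uI).
exists N, m, (slice_pt I x y); split => //; first by exists I.
move=> _ [K uK ->] ne; apply: good => // N0 cK; apply: nobad.
by exists K.
Qed.

End SphereOrders.

Theorem theorem1p7 (R : realType) (r : \bar R) (S : set (quat R))
    (f : quat R -> quat R) :
  (0 < r)%E ->
  semiregular (qball r) S f ->
  exists (T : set (quat R)) (g : quat R -> quat R),
    [/\ T `<=` qball r,
        isolated_points_or_spheres T,
        regular (qball r `\` T) g,
        (forall q, (qball r `\` S) q -> (qball r `\` T) q /\ g q = f q) &
        forall x y : R, y != 0 -> sphere x y `<=` T ->
          exists (n m : nat) (p0 : quat R),
            [/\ sphere x y p0,
                (forall p, sphere x y p -> p <> p0 ->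
                   has_order (qball r `\` S) f p n),
                has_order (qball r `\` S) f p0 m &
                (m <= n)%N]].
Proof.
move=> r0 sf; exists (sym_core S), (extension r S f); split.
- exact: sym_core_qball sf.
- exact: sym_core_isolated sf.
- exact: extension_regular r0 sf.
- by move=> q Dq; split; [exact: D_sub Dq|exact: extension_extends Dq].
- move=> x y y0 sT; apply: sphere_orders => // I uI.
  by apply: sym_core_sub; apply: sT; exists I.
Qed.
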